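(* Let $(R,\mathfrak{n})$ be a Buchsbaum local ring with $\dim R \geq 2$ and $\mathrm{e}(R) > 1$. Choose $f \in \mathfrak{n}$ so that $\dim R/(f) = \dim R - 1$ and put $A = R/(f^n)$ with an integer $n \geq 2$. Let $\mathfrak{m}$ be the maximal ideal of $A$. Then the equality $I^2 = QI$ holds true for every parameter ideal $Q$ in $A$, where $I = Q : \mathfrak{m}$.
   Context: A parameter ideal in a local ring is an ideal generated by a system of parameters. A Noetherian local ring $R$ with maximal ideal $\mathfrak{n}$ and $d = \dim R\geq 1$ is a Buchsbaum ring if the difference $\ell_R(R/Q) - \mathrm{e}^0_Q(R)$ is independent of the choice of a parameter ideal $Q$, where $\mathrm{e}^0_Q(R)$ is the multiplicity of $R$ with respect to $Q$; equivalently, every system of parameters $x_1,\dots,x_d$ satisfies $(x_1,\dots,x_{i-1}):x_i = (x_1,\dots,x_{i-1}):\mathfrak{n}$ for all $1\leq i\leq d$. $\mathrm{e}(R) = \mathrm{e}^0_{\mathfrak{n}}(R)$ is the multiplicity of $R$ with respect to $\mathfrak{n}$. $Q:\mathfrak{m} = \{x\in A \mid x\mathfrak{m}\subseteq Q\}$. *)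

(* Defs.v *)
From HB Require Import structures.
From mathcomp Require Import all_boot all_order all_algebra.
From mathcomp Require Import generic_quotient ring_quotient.
From mathcomp Require Import boolp classical_sets.

Set Implicit Arguments.
Unset Strict Implicit.
Unset Printing Implicit Defensive.

Import GRing.Theory.

Local Open Scope classical_set_scope.
Local Open Scope ring_scope.

(* Ideals are sets in the sense of classical_sets: the ideals of ring_quotient
   are decidable and proper, and live in nontrivial rings only. *)
Definition is_ideal (R : comPzRingType) (I : set R) : Prop :=
  [/\ I 0, (forall x y, I x -> I y -> I (x + y)) &
      (forall a x, I x -> I (a * x))].

Definition is_prime (R : comPzRingType) (P : set R) : Prop :=
  [/\ is_ideal P, ~ P 1 & forall x y, P (x * y) -> P x \/ P y].

Definition is_maximal (R : comPzRingType) (M : set R) : Prop :=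
  [/\ is_ideal M, ~ M 1 &
      forall J : set R, is_ideal J -> ~ J 1 -> M `<=` J -> J = M].

Definition ideal_gen (R : comPzRingType) (S : set R) : set R :=
  smallest (@is_ideal R) S.

Definition ideal_mul (R : comPzRingType) (I J : set R) : set R :=
  ideal_gen [set x * y | x in I & y in J].

Definition ideal_exp (R : comPzRingType) (I : set R) (k : nat) : set R :=
  iter k (ideal_mul I) setT.

Definition ideal_colon (R : comPzRingType) (I J : set R) : set R :=
  [set x | forall y, J y -> I (x * y)].

Definition is_noetherian (R : comPzRingType) : Prop :=
  forall I : set R, is_ideal I ->
  exists (k : nat) (g : 'I_k -> R), I = ideal_gen (range g).

Definition is_local (R : comPzRingType) (m : set R) : Prop :=
  is_maximal m /\ forall M : set R, is_maximal M -> M = m.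

Lemma ideal_gen_ideal (R : comPzRingType) (S : set R) : is_ideal (ideal_gen S).
Proof.
split=> [I [[]] //|x y Ix Iy I HI|a x Ix I HI].
  by have [[_ ID _] _] := HI; apply: ID; [apply: Ix|apply: Iy].
by have [[_ _ IM] _] := HI; apply: IM; apply: Ix.
Qed.

Definition ideal_pred (R : comPzRingType) (S : set R) : {pred R} :=
  [pred x | `[< ideal_gen S x >]].

Lemma ideal_pred_zmod_closed (R : comPzRingType) (S : set R) :
  zmod_closed (ideal_pred S).
Proof.
have [I0 ID IM] := ideal_gen_ideal S.
split=> [|x y /asboolP Ix /asboolP Iy]; apply/asboolP => //.
by apply: ID => //; rewrite -mulN1r; apply: IM.
Qed.

HB.instance Definition _ (R : comPzRingType) (S : set R) :=
  GRing.isZmodClosed.Build R (ideal_pred S) (ideal_pred_zmod_closed S).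

(* quot S is the quotient of R by the ideal generated by S; it is R/(f) when
   S = [set f], and R/I when S is an ideal I. It may be the zero ring. It is
   a commutative ring and also an R-module. *)
Definition quot (R : comPzRingType) (S : set R) : Type :=
  Quotient.quot (ideal_pred S).

HB.instance Definition _ (R : comPzRingType) (S : set R) :=
  GRing.Zmodule.on (quot S).
HB.instance Definition _ (R : comPzRingType) (S : set R) :=
  EqQuotient.on (quot S).

Definition quot_pi (R : comPzRingType) (S : set R) (x : R) : quot S :=
  (\pi_(Quotient.quot (ideal_pred S)) x)%qT.

Lemma quot_pi_eq (R : comPzRingType) (S : set R) (x y : R) :
  quot_pi S x = quot_pi S y <-> ideal_gen S (x - y).
Proof.
have E : (ideal_pred S (x - y)) = (quot_pi S x == quot_pi S y).
  exact: (Quotient.idealrBE (ideal_pred S) x y).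
split=> [/eqP|H]; first by rewrite -E => /asboolP.
by apply/eqP; rewrite -E; apply/asboolP.
Qed.

Definition quot_repr (R : comPzRingType) (S : set R) (x : quot S) : R :=
  repr (x : Quotient.quot (ideal_pred S)).

Lemma quot_reprK (R : comPzRingType) (S : set R) :
  cancel (@quot_repr R S) (quot_pi S).
Proof. by move=> x; rewrite /quot_pi /quot_repr reprK. Qed.

Lemma quot_piD (R : comPzRingType) (S : set R) :
  {morph quot_pi S : x y / x + y}.
Proof. exact: (@Quotient.pi_add R (ideal_pred S)). Qed.

Definition quot_one (R : comPzRingType) (S : set R) : quot S := quot_pi S 1.

Definition quot_mul (R : comPzRingType) (S : set R) (x y : quot S) : quot S :=
  quot_pi S (quot_repr x * quot_repr y).

Lemma quot_piM (R : comPzRingType) (S : set R) (x y : R) :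
  quot_pi S (x * y) = quot_mul (quot_pi S x) (quot_pi S y).
Proof.
have [_ ID IM] := ideal_gen_ideal S.
have H z : ideal_gen S (z - quot_repr (quot_pi S z)).
  by apply/quot_pi_eq; rewrite quot_reprK.
apply/quot_pi_eq; set x' := quot_repr _; set y' := quot_repr _.
have -> : x * y - x' * y' = y * (x - x') + x' * (y - y').
  by rewrite !mulrBr [y * x]mulrC [y * x']mulrC addrA subrK.
by apply: ID; apply: IM; apply: H.
Qed.

Lemma quot_mulA (R : comPzRingType) (S : set R) : associative (@quot_mul R S).
Proof.
move=> x y z; rewrite -[x]quot_reprK -[y]quot_reprK -[z]quot_reprK.
by rewrite -!quot_piM mulrA.
Qed.

Lemma quot_mulC (R : comPzRingType) (S : set R) : commutative (@quot_mul R S).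
Proof. by move=> x y; rewrite /quot_mul mulrC. Qed.

Lemma quot_mul1 (R : comPzRingType) (S : set R) :
  left_id (quot_one S) (@quot_mul R S).
Proof. by move=> x; rewrite -[x]quot_reprK -quot_piM mul1r. Qed.

Lemma quot_mulDl (R : comPzRingType) (S : set R) :
  left_distributive (@quot_mul R S) +%R.
Proof.
move=> x y z; rewrite -[x]quot_reprK -[y]quot_reprK -[z]quot_reprK.
by rewrite -quot_piD -!quot_piM mulrDl quot_piD.
Qed.

HB.instance Definition _ (R : comPzRingType) (S : set R) :=
  GRing.Zmodule_isComPzRing.Build (quot S)
    (@quot_mulA R S) (@quot_mulC R S) (@quot_mul1 R S) (@quot_mulDl R S).

Definition quot_scale (R : comPzRingType) (S : set R) (a : R) (x : quot S) :
  quot S := quot_pi S a * x.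

Lemma quot_scaleA (R : comPzRingType) (S : set R) (a b : R) (x : quot S) :
  quot_scale a (quot_scale b x) = quot_scale (a * b) x.
Proof. by rewrite /quot_scale mulrA [quot_pi S (a * b)]quot_piM. Qed.

Lemma quot_scale1 (R : comPzRingType) (S : set R) :
  left_id 1 (@quot_scale R S).
Proof. by move=> x; rewrite /quot_scale [_ * _]quot_mul1. Qed.

Lemma quot_scaleDr (R : comPzRingType) (S : set R) :
  right_distributive (@quot_scale R S) +%R.
Proof. by move=> a x y; rewrite /quot_scale mulrDr. Qed.

Lemma quot_scaleDl (R : comPzRingType) (S : set R) (x : quot S) :
  {morph (@quot_scale R S)^~ x : a b / a + b}.
Proof. by move=> a b; rewrite /quot_scale quot_piD mulrDl. Qed.

HB.instance Definition _ (R : comPzRingType) (S : set R) :=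
  GRing.Zmodule_isLmodule.Build R (quot S)
    (@quot_scaleA R S) (@quot_scale1 R S) (@quot_scaleDr R S)
    (@quot_scaleDl R S).

(* The chain C 0 < C 1 < ... < C l has length l; only the values of C up to l
   matter. *)
Definition has_chain (T : Type) (P : set (set T)) (l : nat) : Prop :=
  exists C : nat -> set T,
    (forall i, (i <= l)%N -> P (C i)) /\
    (forall i, (i < l)%N -> C i `<` C i.+1).

(* Chains can be truncated, so this says that l is the supremum of the lengths
   of the chains in P. *)
Definition max_chain (T : Type) (P : set (set T)) (l : nat) : Prop :=
  has_chain P l /\ ~ has_chain P l.+1.

Definition krull_dim (R : comPzRingType) (d : nat) : Prop :=
  max_chain (@is_prime R) d.

Definition is_submodule (R : pzRingType) (M : lmodType R) (N : set M) : Prop :=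
  [/\ N 0, (forall x y, N x -> N y -> N (x + y)) &
      (forall (a : R) x, N x -> N (a *: x))].

Definition module_length (R : pzRingType) (M : lmodType R) (l : nat) : Prop :=
  max_chain (@is_submodule R M) l.

(* (x_0, ..., x_(d-1)) with d = dim R generates Q, an ideal of definition of
   the local ring (R, m), that is m^k <= Q <= m for some k. *)
Definition parameter_ideal (R : comPzRingType) (m Q : set R) : Prop :=
  exists (d : nat) (x : 'I_d -> R),
    [/\ krull_dim R d, Q = ideal_gen (range x), Q `<=` m &
        exists k, ideal_exp m k `<=` Q].

(* e = e^0_Q(R), the zeroth of the Hilbert coefficients c_0, ..., c_d:
   l_R(R/Q^(k+1)) = \sum_(i <= d) (-1)^i c_i 'C(k + d - i, d - i) for k >> 0,
   where d = dim R. *)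
Definition multiplicity (R : comPzRingType) (Q : set R) (e : nat) : Prop :=
  exists (d : nat) (c : nat -> int) (N : nat),
    [/\ krull_dim R d, c 0%N = e%:Z &
        forall k, (N <= k)%N ->
        exists2 l : nat,
          @module_length R (quot (ideal_exp Q k.+1)) l &
          l%:Z = \sum_(i < d.+1)
                   (-1) ^+ i * c i * 'C(k + (d - i), d - i)%:Z].

(* The length and the multiplicity of a parameter ideal always exist and are
   unique; b is the constant value of l_R(R/Q) - e^0_Q(R). *)
Definition is_buchsbaum (R : comPzRingType) (m : set R) : Prop :=
  [/\ is_noetherian R, is_local m,
      (exists2 d : nat, krull_dim R d & (1 <= d)%N) &
      exists b : int, forall Q : set R, parameter_ideal m Q ->
      exists l e : nat,
        [/\ @module_length R (quot Q) l, multiplicity Q e & l%:Z - e%:Z = b]].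

(* Main.v *)
Require Import Defs.
From HB Require Import structures.
From mathcomp Require Import all_boot all_order all_algebra.
From mathcomp Require Import boolp classical_sets.
From mathcomp Require Import ring zify.

Set Implicit Arguments.
Unset Strict Implicit.
Unset Printing Implicit Defensive.

Import Order.TTheory GRing.Theory Num.Theory.

Local Open Scope classical_set_scope.
Local Open Scope ring_scope.

(** Lift a parameter ideal of R/(f^n) to the parameter ideal q + (gh) of R, where
   q has dim R - 1 generators, g = f and h = f^(n-1). In a Buchsbaum ring the
   colon U = q : x is the same for every x that completes q to a system of
   parameters, and it equals q : nn. Hence every element of the socle ideal
   J = (q + (gh)) : nn is g c + w with w in U, and likewise g c = h t + v with v in
   U. The condition e(R) > 1 forces t into nn, since otherwise
   nn = (z) + U for some z and then e(R) <= e(q + (z)) <= l(R/(U + (z))) = 1.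
   Comparing coefficients on the generators of q (a syzygy of the a_i has all its
   entries in (a_j : j <> i) : nn) shows that U J lies in q J, while
   (g c)(g c') = gh t c' + v g c' lies in (gh) + q J.

   The colon property is extracted from the constancy of l(R/Q) - e(Q) by two
   inequalities: e(q + (x^2)) <= 2 e(q + (x)), and e(q + (x)) <= l(R/(U + (x)))
   whenever x U <= q. *)

Local Obligation Tactic := idtac.

(** * Ideals as bundled predicates: sums, colons, products and powers *)

Section Ideals.

Variable R : comPzRingType.

Record idl := Idl { car :> R -> Prop; carP : @is_ideal R car }.

Implicit Types (A B C J : idl) (a x y z : R) (s : seq R).

Lemma idl0 A : A 0. Proof. by have [] := carP A. Qed.
Lemma idlD A x y : A x -> A y -> A (x + y).
Proof. by have [_ h _] := carP A; apply: h. Qed.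
Lemma idlM A a x : A x -> A (a * x).
Proof. by have [_ _ h] := carP A; apply: h. Qed.
Lemma idlMr A a x : A x -> A (x * a).
Proof. by rewrite mulrC; apply: idlM. Qed.
Lemma idlN A x : A x -> A (- x).
Proof. by rewrite -mulN1r; apply: idlM. Qed.
Lemma idlB A x y : A x -> A y -> A (x - y).
Proof. by move=> ? ?; apply: idlD => //; apply: idlN. Qed.
Lemma idl_sum A (T : finType) (P : pred T) (F : T -> R) :
  (forall i, P i -> A (F i)) -> A (\sum_(i | P i) F i).
Proof. by move=> h; elim/big_ind: _ => //; [apply: idl0|apply: idlD]. Qed.

Definition sub A B := forall x, A x -> B x.

Lemma sub_refl A : sub A A. Proof. by []. Qed.
Lemma sub_trans B A C : sub A B -> sub B C -> sub A C.
Proof. by move=> h1 h2 x /h1/h2. Qed.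

Definition mk_idl (P : R -> Prop) (h0 : P 0) (hD : forall x y, P x -> P y -> P (x + y))
  (hM : forall a x, P x -> P (a * x)) : idl := @Idl P (And3 h0 hD hM).

Definition top := @mk_idl (fun _ => True) I (fun _ _ _ _ => I) (fun _ _ _ => I).

Program Definition addI A B :=
  @mk_idl (fun x => exists y z, [/\ A y, B z & x = y + z]) _ _ _.
Next Obligation. by exists 0, 0; split; [apply: idl0|apply: idl0|rewrite addr0]. Qed.
Next Obligation.
move=> A B x y [a [b [Aa Bb ->]]] [a' [b' [Aa' Bb' ->]]].
by exists (a + a'), (b + b'); split; [apply: idlD|apply: idlD|ring].
Qed.
Next Obligation.
move=> A B c x [a [b [Aa Bb ->]]].
by exists (c * a), (c * b); split; [apply: idlM|apply: idlM|ring].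
Qed.

Program Definition capI A B := @mk_idl (fun x => A x /\ B x) _ _ _.
Next Obligation. by split; apply: idl0. Qed.
Next Obligation. by move=> A B x y [? ?] [? ?]; split; apply: idlD. Qed.
Next Obligation. by move=> A B a x [? ?]; split; apply: idlM. Qed.

Program Definition colon1 A a := @mk_idl (fun x => A (a * x)) _ _ _.
Next Obligation. by move=> A a /=; rewrite mulr0; apply: idl0. Qed.
Next Obligation. by move=> A a x y /= ? ?; rewrite mulrDr; apply: idlD. Qed.
Next Obligation. by move=> A a b x /= ?; rewrite mulrCA; apply: idlM. Qed.

Program Definition colon A B := @mk_idl (fun x => forall y, B y -> A (x * y)) _ _ _.
Next Obligation. by move=> A B y _ /=; rewrite mul0r; apply: idl0. Qed.
Next Obligation.
by move=> A B x y hx hy z Bz /=; rewrite mulrDl; apply: idlD; [apply: hx|apply: hy].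
Qed.
Next Obligation. by move=> A B a x hx z Bz /=; rewrite -mulrA; apply/idlM/hx. Qed.

Program Definition scI a A := @mk_idl (fun x => exists2 y, A y & x = a * y) _ _ _.
Next Obligation. by move=> a A; exists 0; [apply: idl0|rewrite mulr0]. Qed.
Next Obligation.
by move=> a A x y [u ? ->] [v ? ->]; exists (u + v); [apply: idlD|ring].
Qed.
Next Obligation. by move=> a A b x [u ? ->]; exists (b * u); [apply: idlM|ring]. Qed.

(** Recursion on the list makes membership in [gen (a :: s)] unfold to a decomposition [r * a + y]
    with [y] in [gen s], which the inductions on generators use directly. *)
Fixpoint gen_car s : R -> Prop :=
  if s is a :: s' then fun x => exists r y, gen_car s' y /\ x = r * a + y
  else fun x => x = 0.

Lemma gen_ideal s : @is_ideal R (gen_car s).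
Proof.
elim: s => [|a s [h0 hD hM]] /=.
  by split=> // [x y -> ->|b x ->]; rewrite ?addr0 ?mulr0.
split.
- by exists 0, 0; split => //; rewrite mul0r addr0.
- move=> x y [r [u [hu ->]]] [r' [u' [hu' ->]]].
  by exists (r + r'), (u + u'); split; [apply: hD|ring].
- move=> b x [r [u [hu ->]]].
  by exists (b * r), (b * u); split; [apply: hM|ring].
Qed.
Definition gen s := Idl (gen_ideal s).

Definition genI (S : set R) : idl := Idl (ideal_gen_ideal S).
Definition mulI A B : idl := genI [set x * y | x in (A : set R) & y in (B : set R)].
Fixpoint powI A n : idl := if n is n'.+1 then mulI A (powI A n') else top.

Arguments top : simpl never.
Arguments genI : simpl never.
Arguments mulI : simpl never.
Arguments addI : simpl never.
Arguments gen : simpl never.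

Lemma colon1E A a x : colon1 A a x = A (a * x). Proof. by []. Qed.

Lemma addI_l A B x : A x -> addI A B x.
Proof. by move=> Ax; exists x, 0; split=> //; [apply: idl0|rewrite addr0]. Qed.
Lemma addI_r A B x : B x -> addI A B x.
Proof. by move=> Ax; exists 0, x; split=> //; [apply: idl0|rewrite add0r]. Qed.
Lemma addI_lub A B C : sub A C -> sub B C -> sub (addI A B) C.
Proof. by move=> h1 h2 x [y [z [/h1 ? /h2 ? ->]]]; apply: idlD. Qed.
Lemma addI_mono A B A' B' : sub A A' -> sub B B' -> sub (addI A B) (addI A' B').
Proof.
by move=> hA hB; apply: addI_lub; [apply: sub_trans hA (@addI_l A' B')|apply: sub_trans hB (@addI_r A' B')].
Qed.
Lemma sub_top A : sub A top. Proof. by []. Qed.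
Lemma top1 A : A 1 -> sub top A.
Proof. by move=> A1 x _; rewrite -[x]mulr1; apply: idlM. Qed.

Lemma genI_min (S : set R) A : (forall x, S x -> A x) -> sub (genI S) A.
Proof. by move=> h x; apply; split; [exact: carP|]. Qed.
Lemma genI_sub (S : set R) x : S x -> genI S x.
Proof. by move=> Sx K [_]; apply. Qed.

Lemma mulI_in A B x y : A x -> B y -> mulI A B (x * y).
Proof. by move=> Ax By; apply: genI_sub; exists x => //; exists y. Qed.
Lemma mulI_min A B C :
  (forall x y, A x -> B y -> C (x * y)) -> sub (mulI A B) C.
Proof. by move=> h; apply: genI_min => _ [x Ax [y By <-]]; apply: h. Qed.
Lemma mulI_mono A B A' B' : sub A A' -> sub B B' -> sub (mulI A B) (mulI A' B').
Proof. by move=> hA hB; apply: mulI_min => x y /hA ? /hB ?; apply: mulI_in. Qed.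
Lemma mulIA A B C : sub (mulI (mulI A B) C) (mulI A (mulI B C)).
Proof.
apply: mulI_min => x c ABx Cc.
suff: sub (mulI A B) (colon1 (mulI A (mulI B C)) c) by move/(_ x ABx); rewrite colon1E mulrC.
apply: mulI_min => a b Aa Bb; rewrite colon1E mulrCA [c * b]mulrC.
by apply: mulI_in => //; apply: mulI_in.
Qed.
Lemma mulI_subr A B : sub (mulI A B) B.
Proof. by apply: mulI_min => x y _ By; apply: idlM. Qed.
Lemma mulI_subl A B : sub (mulI A B) A.
Proof. by apply: mulI_min => x y Ax _; apply: idlMr. Qed.
Lemma mulI_bigsub A B (T : finType) (F G : T -> R) :
  (forall i, A (F i)) -> (forall i, B (G i)) -> mulI A B (\sum_i F i * G i).
Proof. by move=> hF hG; apply: idl_sum => i _; apply: mulI_in. Qed.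

Lemma powI_mono A B n : sub A B -> sub (powI A n) (powI B n).
Proof. by move=> h; elim: n => [|n IH] //=; apply: mulI_mono. Qed.
Lemma powI1 A : sub A (powI A 1).
Proof. by move=> x Ax; rewrite -[x]mulr1; apply: mulI_in. Qed.
Lemma powIS A n : sub (powI A n.+1) (powI A n). Proof. exact: mulI_subr. Qed.
Lemma powI_le A m n : (m <= n)%N -> sub (powI A n) (powI A m).
Proof.
move/subnK <-; elim: (n - m)%N => [|k IH] //; rewrite addSn.
exact: sub_trans (@powIS _ _) IH.
Qed.
Lemma powID A m n : sub (mulI (powI A m) (powI A n)) (powI A (m + n)).
Proof.
elim: m => [|m IH]; first exact: mulI_subr.
by rewrite addSn /=; apply: sub_trans (@mulIA _ _ _) _; apply: mulI_mono.
Qed.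
Lemma powI_exp A x n : A x -> powI A n (x ^+ n).
Proof. by move=> Ax; elim: n => [|n IH] //; rewrite exprS; apply: mulI_in. Qed.
Lemma powIM A m n : sub (powI A (m * n)) (powI (powI A m) n).
Proof.
elim: n => [|n IH]; first by rewrite muln0.
rewrite mulnS.
have: forall k, sub (powI A (m + k)) (mulI (powI A m) (powI A k)).
  move=> k; elim: m {IH} => [|m IHm]; first by move=> x hx; rewrite -[x]mul1r; apply: mulI_in.
  rewrite addSn; apply: sub_trans (mulI_mono (@sub_refl A) IHm) _.
  apply: mulI_min => x y Ax; move: y.
  suff: sub (mulI (powI A m) (powI A k)) (colon1 (mulI (mulI A (powI A m)) (powI A k)) x) by [].
  by apply: mulI_min => u v ? ?; rewrite colon1E mulrA; apply: mulI_in => //; apply: mulI_in.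
by move=> h; apply: sub_trans (h (m * n)%N) _; apply: mulI_mono.
Qed.

Lemma gen_tl a s x : gen s x -> gen (a :: s) x.
Proof. by move=> hx; exists 0, x; split => //; rewrite mul0r add0r. Qed.
Lemma gen_hd a s : gen (a :: s) a.
Proof. by exists 1, 0; split; [exact: (idl0 (gen s))|rewrite mul1r addr0]. Qed.
Lemma gen_mem s x : x \in s -> gen s x.
Proof.
elim: s => [|a s IH] //; rewrite inE => /predU1P[->|/IH]; first exact: gen_hd.
exact: gen_tl.
Qed.
Lemma gen_min s A : (forall x, x \in s -> A x) -> sub (gen s) A.
Proof.
elim: s => [|a s IH] h x /=; first by move=> ->; apply: idl0.
move=> [r [y [hy ->]]]; apply: idlD; first by apply/idlM/h; rewrite mem_head.
by apply: IH hy => z hz; apply: h; rewrite inE hz orbT.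
Qed.
Lemma gen_cons_min a s A : A a -> sub (gen s) A -> sub (gen (a :: s)) A.
Proof. by move=> Aa hs x [r [y [/hs ? ->]]]; apply: idlD => //; apply: idlM. Qed.

(** Distinct indices allow the coefficient at a new index to be set without disturbing the others;
    the values of [a] may still repeat. *)
Lemma gen_coef (T : finType) (a : T -> R) (r : seq T) x : uniq r ->
  gen [seq a i | i <- r] x <-> exists u : T -> R, x = \sum_(i <- r) u i * a i.
Proof.
move=> ur; split; last first.
  move=> [u ->]; rewrite big_seq; elim/big_ind: _ => [||i hi]; [exact: idl0|exact: idlD|].
  by apply/idlM/gen_mem/map_f.
elim: r ur x => [|i r IH] /= ur x; first by move=> ->; exists (fun=> 0); rewrite big_nil.
case/andP: ur => nir ur [c [y [/IH -/(_ ur) [u ->] ->]]].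
exists (fun j => if j == i then c else u j); rewrite big_cons eqxx; congr (_ + _).
by apply: eq_big_seq => j jr; case: eqVneq => // ji; rewrite -ji jr in nir.
Qed.

End Ideals.

(** * Lengths of intervals of ideals *)

Section Length.

Variable R : comPzRingType.
Implicit Types (A B C X Y J G : idl R) (l n g : nat) (c x : R).

(** The chain starts at [A] itself and makes [l] strict steps, but its last term only has to lie in
    [B]. Hence shrinking [A] or enlarging [B] preserves chains. *)
Fixpoint ichain l A B : Prop :=
  if l is l'.+1 then exists C, [/\ sub A C, ~ sub C A & ichain l' C B] else sub A B.

(* Lengths of ideal intervals enter through upper bounds and explicit chains, so
   that no finiteness has to be known in advance. *)
Definition length_le A B n := forall l, ichain l A B -> (l <= n)%N.

Lemma ichain_sub l A B : ichain l A B -> sub A B.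
Proof.
elim: l A => [|l IH] A //= [C [hAC _ /IH hCB]]; exact: sub_trans hAC hCB.
Qed.
Lemma ichain_l l A A' B : sub A' A -> ichain l A B -> ichain l A' B.
Proof.
case: l => [|l] hA /=; first exact: sub_trans.
move=> [C [hAC hCA hC]]; exists C; split=> //; first exact: sub_trans hA hAC.
by move=> h; apply: hCA; apply: sub_trans h hA.
Qed.
Lemma ichain_r l A B B' : sub B B' -> ichain l A B -> ichain l A B'.
Proof.
move=> hB; elim: l A => [|l IH] A /=; first by move=> h; apply: sub_trans h hB.
by move=> [C [? ? /IH ?]]; exists C.
Qed.
Lemma ichain_le l m A B : (m <= l)%N -> ichain l A B -> ichain m A B.
Proof.
elim: m l A => [|m IH] [|l] A // hml; first exact: ichain_sub.
by move=> [C [? ? /(IH l) h]]; exists C; split=> //; apply: h.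
Qed.
Lemma ichain_cat l1 l2 A B C : ichain l1 A B -> ichain l2 B C -> ichain (l1 + l2) A C.
Proof.
elim: l1 A => [|l1 IH] A /= h1 h2; first exact: ichain_l h1 h2.
by case: h1 => [D [? ? /IH/(_ h2) ?]]; exists D.
Qed.

(** The modular law: if [y = x + b], then [y - x] lies in both [Y] and [B], hence in [X]. *)
Lemma modular_sub X Y B : sub X Y -> sub (capI Y B) (capI X B) ->
  sub (addI Y B) (addI X B) -> sub Y X.
Proof.
move=> hXY hcap hadd y Yy.
have [x [b [Xx Bb yE]]] := hadd y (addI_l _ Yy).
have -> : y = x + (y - x) by ring.
apply: idlD => //.
suff /hcap[] : capI Y B (y - x) by [].
split; first by apply: idlB => //; apply: hXY.
by rewrite yE addrC addKr.
Qed.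

(** By the modular law, each strict step stays strict after intersecting with [B] or after adding
    [B]. This yields the subadditivity of length. *)
Lemma ichain_split l X B C : sub B C -> ichain l X C ->
  exists l1 l2, [/\ l = (l1 + l2)%N, ichain l1 (capI X B) B & ichain l2 (addI X B) C].
Proof.
move=> hBC; elim: l X => [|l IH] X /=.
  move=> hXC; exists 0%N, 0%N; split=> //; first by move=> x [].
  exact: addI_lub.
move=> [Y [hXY hYX /IH [l1 [l2 [-> h1 h2]]]]].
have hc : sub (capI X B) (capI Y B) by move=> x [/hXY].
have ha : sub (addI X B) (addI Y B) by apply: addI_mono.
case: (pselect (sub (capI Y B) (capI X B))) => [hcap|hcap]; last first.
  by exists l1.+1, l2; split=> //; [exists (capI Y B)|apply: ichain_l ha h2].
case: (pselect (sub (addI Y B) (addI X B))) => [hadd|hadd].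
  by case: hYX; apply: modular_sub hcap hadd.
exists l1, l2.+1; split; [by rewrite addnS|exact: ichain_l hc h1|].
by exists (addI Y B).
Qed.

(** Strictness survives as soon as [phi] reflects inclusions between nested ideals of the
    interval. *)
Lemma ichain_map (phi : idl R -> idl R) l A B B' :
  (forall J, sub A J -> sub J B -> sub (phi J) B') ->
  (forall J J', sub J J' -> sub (phi J) (phi J')) ->
  (forall J J', sub A J -> sub J J' -> sub J' B -> sub (phi J') (phi J) -> sub J' J) ->
  ichain l A B -> ichain l (phi A) B'.
Proof.
move=> hB hmono hrefl.
suff: forall X, sub A X -> ichain l X B -> ichain l (phi X) B' by apply.
elim: l => [|l IH] X hAX /=; first exact: hB.
move=> [Y [hXY hYX hY]]; exists (phi Y); split; first exact: hmono.
  by move=> h; apply/hYX/(hrefl _ _ hAX hXY (ichain_sub hY)).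
by apply: IH => //; apply: sub_trans hAX hXY.
Qed.

Lemma length_le_le A B n m : (n <= m)%N -> length_le A B n -> length_le A B m.
Proof. by move=> hnm h l /h hl; apply: leq_trans hl hnm. Qed.
Lemma length_le_mono A B A' B' n : sub A A' -> sub B' B -> length_le A B n -> length_le A' B' n.
Proof. by move=> hA hB h l hl; apply: h; apply: ichain_l hA _; apply: ichain_r hB _. Qed.
Lemma length_le_sub0 A B : sub B A -> length_le A B 0.
Proof.
move=> h [|l] // [C [hAC hCA /ichain_sub hCB]]; case: hCA; exact: sub_trans hCB h.
Qed.
Lemma length_le_add A B C n1 n2 : sub A B -> sub B C ->
  length_le A B n1 -> length_le B C n2 -> length_le A C (n1 + n2).
Proof.
move=> hAB hBC h1 h2 l /(ichain_split hBC) [l1 [l2 [-> hl1 hl2]]].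
apply: leq_add; [apply: h1|apply: h2].
  by apply: ichain_l hl1 => x Ax; split=> //; apply: hAB.
by apply: ichain_l hl2; apply: addI_r.
Qed.
Lemma length_le_map (phi : idl R -> idl R) A B A' B' n :
  sub A' (phi A) ->
  (forall J, sub A J -> sub J B -> sub (phi J) B') ->
  (forall J J', sub J J' -> sub (phi J) (phi J')) ->
  (forall J J', sub A J -> sub J J' -> sub J' B -> sub (phi J') (phi J) -> sub J' J) ->
  length_le A' B' n -> length_le A B n.
Proof.
by move=> hA hB hm hr h l hl; apply: h; apply: ichain_l hA _; apply: ichain_map hl.
Qed.
Lemma length_le_max A B n : sub A B -> length_le A B n -> exists2 g, ichain g A B & length_le A B g.
Proof.
move=> hAB h; have ex : exists g, `[< ichain g A B >] by exists 0%N; apply/asboolP.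
have ub g : `[< ichain g A B >] -> (g <= n)%N by move/asboolP/h.
case: (ex_maxnP ex ub) => g /asboolP hg hmax; exists g => // l hl.
by apply: hmax; apply/asboolP.
Qed.
Lemma length_le_split A B C n : sub A B -> sub B C -> length_le A C n ->
  exists v1 v2, [/\ (v1 + v2 <= n)%N, length_le A B v1 & length_le B C v2].
Proof.
move=> hAB hBC h.
have [v1 c1 l1] := length_le_max hAB (length_le_mono (@sub_refl _ A) hBC h).
have [v2 c2 l2] := length_le_max hBC (length_le_mono hAB (@sub_refl _ C) h).
by exists v1, v2; split=> //; apply: h; apply: ichain_cat c1 c2.
Qed.
(** If [B] were strictly larger than [A], putting [A] in front of the chain from [B] would give a
    chain of length [g.+1]. *)
Lemma length_le_eq A B C g : sub A B -> length_le A C g -> ichain g B C -> sub B A.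
Proof.
move=> hAB h hg; apply: contrapT => hBA.
by have: ichain g.+1 A C; [exists B|move/h; rewrite ltnn].
Qed.

(** Multiplication by [c] induces a surjection from [B/B'] onto [(A + cB)/A]; chains are pulled back
    along it by intersecting [J : c] with [B]. *)
Lemma length_le_mul A c B B' n : sub B' B -> (forall y, B' y -> A (c * y)) ->
  length_le B' B n -> length_le A (addI A (scI c B)) n.
Proof.
move=> hB' hc; apply: (length_le_map (phi := fun J => capI (colon1 J c) B)).
- by move=> y By; split; [apply: hc|apply: hB'].
- by move=> J _ _ y [].
- by move=> J J' h y [? ?]; split=> //; apply: h.
move=> J J' hA hJJ' hJ' h y J'y; have [a [_ [Aa [b Bb ->] yE]]] := hJ' y J'y.
rewrite yE; apply: idlD; first exact: hA.
suff /h[] : capI (colon1 J' c) B b by [].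
split=> //; rewrite colon1E; have -> : c * b = y - a by rewrite yE addrC addKr.
by apply: idlB => //; apply/hJJ'/hA.
Qed.

(** The reverse estimate: passing from [J] to [A + cJ] keeps steps above [G] strict, because [A : c]
    lies in [G]. *)
Lemma ichain_mul A c G B g : sub (colon1 A c) G -> ichain g G B ->
  ichain g A (addI A (scI c B)).
Proof.
move=> hG hg; apply: ichain_l (@addI_l _ A (scI c G)) _.
apply: (ichain_map (phi := fun J => addI A (scI c J))) hg.
- by move=> J _ hJ; apply: addI_mono => // _ [y /hJ By ->]; exists y.
- by move=> J J' h; apply: addI_mono => // _ [y /h By ->]; exists y.
move=> J J' hGJ _ _ h y J'y.
have hcy : scI c J' (c * y) by exists y.
have [a [_ [Aa [z Jz ->] yE]]] := h (c * y) (addI_r _ hcy).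
have -> : y = (y - z) + z by ring.
apply: idlD => //; apply/hGJ/hG; rewrite colon1E mulrBr yE.
by rewrite addrK.
Qed.

End Length.

(** * Noetherian local rings *)

Section NoetherianLocal.

Variable R : comPzRingType.
Hypothesis noeth : is_noetherian R.
Implicit Types (A B C J : idl R) (a x y z : R) (s : seq R).

(** The union of the chain is an ideal, and its finitely many generators all appear at one stage. *)
Lemma acc (C : nat -> idl R) : (forall n, sub (C n) (C n.+1)) ->
  exists N, forall n, sub (C n) (C N).
Proof.
move=> hC.
have mono m n : (m <= n)%N -> sub (C m) (C n).
  move/subnK <-; elim: (n - m)%N => [|k IH] //; exact: sub_trans IH (hC _).
have hU : @is_ideal R [set x | exists n, C n x].
  split; [by exists 0%N; apply: idl0| |].
    move=> x y [m hx] [n hy]; exists (maxn m n).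
    by apply: idlD; [apply: mono hx; apply: leq_maxl|apply: mono hy; apply: leq_maxr].
  by move=> a x [n hx]; exists n; apply: idlM.
have [k [g gE]] := noeth hU.
have hg i : exists n, C n (g i).
  have: ideal_gen (range g) (g i) by move=> K [_]; apply; exists i.
  by rewrite -gE.
have /choice[f hf] := hg.
exists (\max_i f i) => n x hx.
have: [set x | exists n, C n x] x by exists n.
rewrite gE; apply; split; first exact: carP.
by move=> _ [i _ <-]; apply: mono (hf i); apply: leq_bigmax.
Qed.

Lemma stable_colon A x : exists N, forall n, sub (colon1 A (x ^+ n)) (colon1 A (x ^+ N)).
Proof.
by apply: acc => n y; rewrite !colon1E exprS -mulrA; apply: idlM.
Qed.

Variable nn : idl R.
Hypothesis hloc : @is_local R nn.

Lemma nn1 : ~ nn 1. Proof. by have [[]] := hloc. Qed.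

(** The chain condition takes the place of Zorn's lemma. A proper ideal above [(x)] cannot be
    maximal, since it would then be [nn]; so it could be enlarged forever if [x] were not a unit. *)
Lemma unit_ex x : ~ nn x -> exists u, u * x = 1.
Proof.
move=> hx; apply: contrapT => hu.
pose A := gen [:: x].
have A1 : ~ A 1.
  by move=> [r [y [-> /eqP]]]; rewrite addr0 eq_sym => /eqP rx; apply: hu; exists r.
have ext : forall J, exists J', sub A J -> ~ J 1 -> [/\ sub J J', ~ sub J' J & ~ J' 1].
  move=> J; case: (pselect (sub A J /\ ~ J 1)) => [[hAJ hJ1]|h]; last first.
    by exists J => h1 h2; case: h.
  case: (pselect (exists J', [/\ sub J J', ~ sub J' J & ~ J' 1])) => [[J' h]|h].
    by exists J'.
  have Jmax : @is_maximal R J.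
    split=> [||K hK K1 hJK]; [exact: carP|by []|].
    rewrite eqEsubset; split=> //; apply: contrapT => hKJ; apply: h.
    by exists (Idl hK); split.
  by case: hx; have [_ /(_ _ Jmax) <-] := hloc; apply: hAJ; apply: gen_hd.
have /choice[f hf] := ext.
pose C n := iter n f A.
have hC n : [/\ sub A (C n), ~ C n 1, sub (C n) (C n.+1) & ~ sub (C n.+1) (C n)].
  have [hA h1] : sub A (C n) /\ ~ C n 1.
    elim: n => [|n [hA h1]]; first by split.
    have [h2 h3 h4] := hf _ hA h1.
    by split=> //; apply: sub_trans hA h2.
  by have [h2 h3 h4] := hf _ hA h1.
have [N hN] := @acc C (fun n => let: And4 _ _ h _ := hC n in h).
by have [_ _ _] := hC N; apply; apply: hN.
Qed.

Lemma unit_1B x : nn x -> exists u, u * (1 - x) = 1.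
Proof.
move=> hx; apply: unit_ex => h; apply: nn1.
by have := idlD h hx; rewrite subrK.
Qed.

Lemma nn_max A : sub nn A -> sub A nn \/ A 1.
Proof.
move=> h; case: (pselect (A 1)) => A1; [by right|left].
have [[_ _ hm] _] := hloc; have AE := hm (A : set R) (carP A) A1 h.
by move=> x; rewrite -[nn x]/((nn : set R) x) -AE.
Qed.

Lemma length_le_nn : length_le nn (top R) 1.
Proof.
move=> [|l] // [C [hC hCn hl]]; case: (nn_max hC) => // /top1 C1.
by case: l hl => // l [D [_ hD _]]; case: hD; apply: sub_trans C1.
Qed.

(* Krull's intersection theorem for the powers of one element modulo A. *)
Lemma bigcap_pow A x t : nn x ->
  (forall k, exists r, A (t - x ^+ k * r)) -> A t.
Proof.
move=> hx /choice[r hr].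
have [N hN] := stable_colon A x; set Z := colon1 A (x ^+ N).
have step k : (N <= k)%N -> Z (r k - x * r k.+1).
  move=> hk; apply: (hN k); rewrite colon1E.
  have -> : x ^+ k * (r k - x * r k.+1) = (t - x ^+ k.+1 * r k.+1) - (t - x ^+ k * r k).
    by rewrite exprSr; ring.
  exact: idlB.
(* Modulo [Z], [r k] equals [x * r k.+1], so the ideals [Z + (r k)] ascend. Once they stop, [r k.+1]
   is [c * x * r k.+1] modulo [Z], and [1 - c * x] is a unit. *)
have hacc n : sub (addI Z (gen [:: r (N + n)%N])) (addI Z (gen [:: r (N + n.+1)%N])).
  apply: addI_lub; first by move=> y; apply: addI_l.
  apply: gen_cons_min => [|y ->]; last exact: idl0.
  have -> : r (N + n)%N = (r (N + n)%N - x * r (N + n.+1)%N) + x * r (N + n.+1)%N by ring.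
  apply: idlD; first by apply: addI_l; rewrite addnS; apply: step; apply: leq_addr.
  by apply: idlM; apply: addI_r; apply: gen_hd.
have [M hM] := acc hacc.
pose k := (N + M)%N.
have [z [_ [Zz [c [_ [-> ->]] rE]]]] : addI Z (gen [:: r k]) (r k.+1).
  by have := hM M.+1; rewrite addnS; apply; apply: addI_r; apply: gen_hd.
rewrite addr0 in rE.
have Zr : Z (r k.+1).
  have [u hu] := unit_1B (idlM c hx).
  rewrite -[r k.+1]mul1r -hu -mulrA; apply: idlM.
  have -> : (1 - c * x) * r k.+1 = z + c * (r k - x * r k.+1).
    by rewrite mulrBl mul1r {1}rE; ring.
  by apply: idlD => //; apply/idlM/step/leq_addr.
have -> : t = (t - x ^+ k.+1 * r k.+1) + x ^+ k.+1 * r k.+1 by ring.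
apply: idlD; first exact: hr.
have -> : x ^+ k.+1 = x ^+ M.+1 * x ^+ N by rewrite -exprD; congr (_ ^+ _); rewrite /k; lia.
by rewrite -mulrA; apply: idlM; move: Zr; rewrite /Z colon1E.
Qed.

End NoetherianLocal.

(** * Upper bounds for the colengths of powers of an ideal *)

Section HilbertBounds.

Variable R : comPzRingType.
Implicit Types (A B C J P T U : idl R) (c x y v : R) (s : seq R).

(* The number of monomials of degree n in r variables. *)
Fixpoint monom r n : nat := if r is r'.+1 then \sum_(i < n.+1) monom r' i else (n == 0)%N.

Lemma monom0 r : monom r 0 = 1%N.
Proof. by elim: r => // r IH; rewrite /= big_ord1. Qed.
Lemma monomS r n : monom r.+1 n.+1 = (monom r n.+1 + monom r.+1 n)%N.
Proof. by rewrite /= big_ord_recr addnC. Qed.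
Lemma monomE r n : monom r.+1 n = 'C(n + r, r).
Proof.
elim: r n => [|r IHr] n.
  by elim: n => [|n IHn]; rewrite ?monom0 // monomS IHn !bin0.
elim: n => [|n IHn]; first by rewrite monom0 add0n binn.
by rewrite monomS IHr IHn !addSn !addnS [RHS]binS addnC.
Qed.

(** A monomial of degree [n.+1] either avoids [x] or is [x] times a monomial of degree [n]. *)
Lemma pow_cons x s n : sub (powI (gen (x :: s)) n.+1)
  (addI (powI (gen s) n.+1) (scI x (powI (gen (x :: s)) n))).
Proof.
elim: n => [|n IH]; apply: mulI_min => y z [r [w [hw ->]]].
  move=> _; rewrite mulrDl addrC; apply: idlD.
    by apply: addI_l; apply: mulI_in.
  by apply: addI_r; exists (r * z) => //; ring.
move=> hz; have [z1 [_ [hz1 [z2 hz2 ->] zE]]] := IH _ hz.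
have -> : (r * x + w) * z = w * z1 + (x * (r * z) + x * (w * z2)).
  by rewrite mulrDl {2}zE; ring.
apply: idlD; first by apply: addI_l; apply: mulI_in.
apply: addI_r; exists (r * z + w * z2); last by ring.
apply: idlD; first exact: idlM.
by apply: mulI_in => //; apply: gen_tl.
Qed.

Lemma pow_nil n y : powI (gen (Nil R)) n.+1 y -> y = 0.
Proof. by move/mulI_subl. Qed.

(** The ideal added to [A] is generated by [c] times the [monom (size s) n] monomials of degree [n]
    in [s]. Each costs at most [t], as [T] multiplies it into [A]. The nested induction separates
    the monomials divisible by the first generator. *)
Lemma cost_pow T t s n A c :
  (forall y v, powI (gen s) n y -> T v -> A (c * y * v)) -> length_le T (top R) t ->
  length_le A (addI A (scI c (powI (gen s) n))) (monom (size s) n * t).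
Proof.
move=> + hT.
have h0 s' A' c' : (forall y v, powI (gen s') 0 y -> T v -> A' (c' * y * v)) ->
    length_le A' (addI A' (scI c' (powI (gen s') 0))) t.
  move=> h; apply: length_le_mul hT => // v Tv.
  by rewrite -[c']mulr1; apply: h.
elim: s n A c => [|a s IHs] n A c.
  case: n => [|n] h; first by rewrite mul1n; apply: h0.
  rewrite mul0n; apply: length_le_sub0; apply: addI_lub => // _ [y /pow_nil -> ->].
  by rewrite mulr0; apply: idl0.
elim: n A c => [|n IHn] A c h; first by rewrite monom0 mul1n; apply: h0.
rewrite monomS mulnDl.
set A' := addI A (scI c (powI (gen s) n.+1)).
have hA : sub A A' by move=> y; apply: addI_l.
have hA' : sub A' (addI A' (scI (c * a) (powI (gen (a :: s)) n))).
  by move=> y; apply: addI_l.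
apply: (@length_le_mono _ A (addI A' (scI (c * a) (powI (gen (a :: s)) n)))) => //.
  apply: addI_lub => [y hy|_ [y /pow_cons [y1 [_ [hy1 [y2 hy2 ->] ->]]] ->]].
    by apply/hA'/hA.
  rewrite mulrDr; apply: idlD.
    by apply: hA'; apply: addI_r; exists y1.
  by apply: addI_r; exists y2 => //; ring.
apply: (length_le_add hA hA').
  apply: IHs => y v hy Tv; apply: h => //.
  by apply: powI_mono hy => z; apply: gen_tl.
apply: IHn => y v hy Tv; apply: hA.
rewrite -[c * a * y]mulrA; apply: h => //; apply: mulI_in => //; exact: gen_hd.
Qed.

Section Multiplicity.

Variables (s : seq R) (x : R) (U : idl R) (t lam : nat).
Let q := gen s.
Let Q := gen (x :: s).
Hypothesis hU : forall u, U u -> q (x * u).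
Hypothesis ht : length_le (addI U Q) (top R) t.
Hypothesis hlam : length_le Q (top R) lam.

Let qQ : sub q Q. Proof. by move=> y; apply: gen_tl. Qed.

(* A generator c x^(j+1) a^i of the layer is killed, modulo what was added before
   it, not only by Q but also by U, as x U <= q. *)
Lemma cost_mul n A c :
  (forall y v, powI Q n y -> Q v -> A (c * x * y * v)) ->
  (forall y, powI q n.+1 y -> A (c * y)) ->
  length_le A (addI A (scI (c * x) (powI Q n))) (monom (size s).+1 n * t).
Proof.
elim: n A c => [|n IHn] A c h1 h2.
  rewrite monom0 mul1n; apply: length_le_mul ht => // y [u [v [Uu Qv ->]]].
  rewrite mulrDr; apply: idlD; last by rewrite -[c * x]mulr1; apply: h1.
  by rewrite -mulrA; apply: h2; apply: powI1; apply: hU.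
rewrite monomS mulnDl.
set A' := addI A (scI (c * x) (powI q n.+1)).
have hA : sub A A' by move=> y; apply: addI_l.
have hA' : sub A' (addI A' (scI (c * x * x) (powI Q n))).
  by move=> y; apply: addI_l.
apply: (@length_le_mono _ A (addI A' (scI (c * x * x) (powI Q n)))) => //.
  apply: addI_lub => [y hy|_ [y /pow_cons [y1 [_ [hy1 [y2 hy2 ->] ->]]] ->]].
    by apply/hA'/hA.
  rewrite mulrDr; apply: idlD.
    by apply: hA'; apply: addI_r; exists y1.
  by apply: addI_r; exists y2 => //; ring.
apply: (length_le_add hA hA').
  apply: cost_pow ht => y _ hy [u [v [Uu Qv ->]]].
  rewrite mulrDr; apply: idlD; last by apply: h1 => //; apply: powI_mono hy.
  have -> : c * x * y * u = c * ((x * u) * y) by ring.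
  by apply: h2; apply: mulI_in => //; apply: hU.
apply: IHn => [y v hy Qv|y hy]; last by apply: addI_r; exists y.
apply: hA; rewrite -[c * x * x * y]mulrA; apply: h1 => //.
by apply: mulI_in => //; apply: gen_hd.
Qed.

(** A monomial of degree [n.+1] free of [x] costs at most [lam], as [Q] multiplies it into the next
    power; one divisible by [x] costs at most [t] by [cost_mul]. *)
Lemma cost_layer n : length_le (powI Q n.+2) (powI Q n.+1)
  (monom (size s) n.+1 * lam + monom (size s).+1 n * t).
Proof.
set A := powI Q n.+2; pose A' := addI A (scI 1 (powI q n.+1)).
have hA : sub A A' by move=> y; apply: addI_l.
have hA' : sub A' (addI A' (scI (1 * x) (powI Q n))) by move=> y; apply: addI_l.
apply: (@length_le_mono _ A (addI A' (scI (1 * x) (powI Q n)))) => //.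
  move=> _ /pow_cons [y1 [_ [hy1 [y2 hy2 ->] ->]]]; apply: idlD.
    by apply/hA'/addI_r; exists y1; rewrite ?mul1r.
  by apply: addI_r; exists y2; rewrite ?mul1r.
apply: (length_le_add hA hA').
  apply: cost_pow hlam => y v hy Qv; rewrite mul1r mulrC; apply: mulI_in => //.
  exact: powI_mono hy.
apply: cost_mul => [y v hy Qv|y hy]; last by apply: addI_r; exists y.
apply: hA; rewrite mul1r mulrC; apply: mulI_in => //; apply: mulI_in => //.
exact: gen_hd.
Qed.

(** The layers are summed. The term in [t] has degree [size s + 1] in [k] and the term in [lam] has
    degree [size s], so only [t] reaches the leading coefficient. *)
Lemma hilbert_bound k :
  length_le (powI Q k.+1) (top R) (lam * monom (size s).+1 k + t * monom (size s).+2 k).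
Proof.
elim: k => [|k IH].
  rewrite !monom0 !muln1; apply: length_le_le (leq_addr _ _) _.
  by apply: length_le_mono hlam => //; apply: powI1.
have := length_le_add (@powIS _ Q k.+1) (@sub_top _ _) (@cost_layer k) IH.
apply: length_le_le; rewrite (monomS (size s) k) (monomS (size s).+1 k).
rewrite (monomS (size s) k) !mulnDr; nia.
Qed.

End Multiplicity.

Section DoubleParameter.

Variables (s : seq R) (x : R).
Let q := gen s.
Let Q := gen (x :: s).
Let Q2 := gen (x ^+ 2 :: s).

Let qQ : sub q Q. Proof. by move=> y; apply: gen_tl. Qed.

(** A monomial of degree [i + m.+1] has degree at least [i.+1] in [s], or else is divisible by
    [x ^+ m.+1]. *)
Lemma pow_split i m : sub (powI Q (i + m.+1))
  (addI (mulI (powI q i.+1) (powI Q m)) (scI (x ^+ m.+1) (powI Q i))).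
Proof.
elim: m => [|m IH].
  rewrite addn1 => y /pow_cons [y1 [_ [hy1 [y2 hy2 ->] ->]]]; apply: idlD.
    by apply: addI_l; rewrite -[y1]mulr1; apply: mulI_in.
  by apply: addI_r; exists y2; rewrite ?expr1.
rewrite addnS; apply: mulI_min => y z [r [w [hw ->]]] hz.
have [z1 [_ [hz1 [z2 hz2 ->] ->]]] := IH _ hz.
have [p [_ [hp [z3 hz3 ->] pE]]] := pow_cons (mulI_in (qQ hw) hz2).
have -> : (r * x + w) * (z1 + x ^+ m.+1 * z2) =
    (r * x + w) * z1 + (p * x ^+ m.+1 + x ^+ m.+2 * (r * z2 + z3)).
  rewrite (exprS x m.+1); set e := x ^+ m.+1.
  have -> : (r * x + w) * (z1 + e * z2) = (r * x + w) * z1 + (e * (x * (r * z2)) + e * (w * z2)) by ring.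
  by rewrite pE; ring.
apply: idlD; last apply: idlD.
- apply: addI_l.
  have hQ : Q (r * x + w) by exists r, w.
  suff h : sub (mulI (powI q i.+1) (powI Q m))
               (colon1 (mulI (powI q i.+1) (powI Q m.+1)) (r * x + w)) by exact: h hz1.
  apply: mulI_min => a b ha hb; rewrite colon1E mulrCA.
  by apply: mulI_in => //; apply: mulI_in.
- by apply: addI_l; apply: mulI_in => //; apply: powI_exp; apply: gen_hd.
- by apply: addI_r; exists (r * z2 + z3) => //; apply: idlD => //; apply: idlM.
Qed.

Lemma Qsq_sub : sub (powI Q 2) Q2.
Proof.
apply: mulI_min => _ z [r [w [hw ->]]] /mulI_subl [r' [w' [hw' ->]]].
have -> : (r * x + w) * (r' * x + w') = (r * r') * x ^+ 2 + (r * x * w' + (r' * x + w') * w) by ring.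
by exists (r * r'), (r * x * w' + (r' * x + w') * w); split=> //; apply: (@idlD _ q); apply: idlM.
Qed.

Lemma Qpow_double m : sub (powI Q (2 * m)) (powI Q2 m).
Proof. by apply: sub_trans (@powIM _ _ _ _) _; apply: powI_mono; apply: Qsq_sub. Qed.

(* With n = 2k - 1 - j, multiplication by x^(n-j) maps Q^j/Q^(j+1) onto the layer
   (P + Q^n)/(P + Q^(n+1)), P = Q2^k, for k <= n < 2k. *)
Lemma hilbert_double (k v : nat) : length_le (powI Q k) (top R) v -> length_le (powI Q2 k) (top R) (2 * v).
Proof.
move=> hv; set P := powI Q2 k.
have phase j : (j <= k)%N -> forall w : nat, length_le (powI Q j) (top R) w ->
    length_le (addI P (powI Q (2 * k))) (addI P (powI Q (2 * k - j))) w.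
  elim: j => [|j IH] hj w hw.
    by rewrite subn0; apply: length_le_le (leq0n _) _; apply: length_le_sub0.
  have [v1 [v2 [hvv h1 h2]]] := length_le_split (@powIS _ Q j) (@sub_top _ _) hw.
  apply: length_le_le hvv _; rewrite addnC; set n := (2 * k - j.+1)%N.
  have nE : (2 * k - j = n.+1)%N by rewrite /n; lia.
  have h3 := IH (ltnW hj) _ h2; rewrite nE in h3.
  apply: (fun a b => length_le_add a b h3).
  - by apply: addI_mono => //; rewrite -nE; apply: powI_le; lia.
  - by apply: addI_mono => //; apply: powIS.
  pose m := (n - j.+1)%N; have nE' : n = (j + m.+1)%N by rewrite /m; lia.
  apply: (length_le_mono _ _ (length_le_mul (A := addI P (powI Q n.+1)) (c := x ^+ m.+1) (@powIS _ Q j) _ h1)) => //.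
    apply: addI_lub => y; first by move=> hy; do 2!apply: addI_l.
    rewrite nE' => /pow_split [y1 [y2 [hy1 hy2 ->]]].
    apply: idlD; last exact: addI_r.
    do 2!apply: addI_l; rewrite /P; have -> : k = (j.+1 + (k - j.+1))%N by lia.
    apply: powID; apply: mulI_mono hy1; first by apply: powI_mono => z; apply: gen_tl.
    have -> : m = (2 * (k - j.+1))%N by rewrite /m /n; lia.
    exact: Qpow_double.
  move=> y hy; apply: addI_r; rewrite nE' -addSn addnC.
  by apply: powID; apply: mulI_in => //; apply: powI_exp; apply: gen_hd.
have hPQ : sub (addI P (powI Q (2 * k))) (addI P (powI Q k)).
  by apply: addI_mono => //; apply: powI_le; lia.
have := phase k (leqnn k) v hv; have -> : (2 * k - k = k)%N by lia.
move=> h1; have h2 : length_le (addI P (powI Q k)) (top R) v.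
  by apply: length_le_mono hv => // y; apply: addI_r.
rewrite mul2n -addnn; apply: (length_le_mono _ _ (length_le_add hPQ (@sub_top _ _) h1 h2)) => //.
by apply: addI_lub => //; apply: Qpow_double.
Qed.

End DoubleParameter.

End HilbertBounds.

(** * Hilbert polynomials and their leading coefficients *)

Definition hilb d (c : nat -> int) k : int :=
  \sum_(i < d.+1) (-1) ^+ i * c i * 'C(k + (d - i), d - i)%:Z.

Lemma bin_mono k m m' : (m <= m')%N -> ('C(k + m, m) <= 'C(k + m', m'))%N.
Proof.
move=> h; rewrite -!(addnC _ k) -[in X in (X <= _)%N](bin_sub (leq_addr k m)) addKn.
by rewrite -[in X in (_ <= X)%N](bin_sub (leq_addr k m')) addKn leq_bin2l // leq_add2r.
Qed.

(** If [c 0] were at most -1, the lower terms, bounded by [B] times ['C(k + d, d)], would have to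
    outweigh ['C(k + d.+1, d.+1)]. The ratio of these binomials is [(k + d.+1) / d.+1], which
    exceeds [B] for the chosen [k]. *)
Lemma hilb_ge0 d c N : (forall k, (N <= k)%N -> 0 <= hilb d c k) -> 0 <= c 0%N.
Proof.
case: d => [|d] h.
  by have := h N (leqnn N); rewrite /hilb big_ord1 /= expr0 mul1r bin0 mulr1.
rewrite leNgt; apply/negP => c0.
pose B := \sum_(i < d.+1) `|c i.+1|%N.
pose k := (N + d.+1 * B)%N.
have := h k (leq_addr _ _); rewrite /hilb big_ord_recl /= expr0 mul1r subn0.
set S := \sum_(i < d.+1) _; set D := 'C(k + d, d).
have hS : S <= (B * D)%N%:Z.
  rewrite /B big_distrl /= raddf_sum /=; apply: ler_sum => i _.
  rewrite /bump /= add1n subSS PoszM.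
  apply: le_trans (ler_norm _) _; rewrite !normrM normrX normrN1 expr1n mul1r.
  rewrite abszE ler_wpM2l //; rewrite ger0_norm // lez_nat; apply: bin_mono.
  exact: leq_subr.
have hE : (d.+1 * 'C(k + d.+1, d.+1) = (k + d.+1) * D)%N.
  by rewrite -mul_bin_diag addnS.
have D0 : (0 < D)%N by rewrite bin_gt0 leq_addl.
move=> h0.
have h1 : c 0%N * 'C(k + d.+1, d.+1)%:Z <= - 'C(k + d.+1, d.+1)%:Z.
  by rewrite -mulN1r ler_wpM2r //; lia.
have h2 : ('C(k + d.+1, d.+1) <= B * D)%N by lia.
have h3 : ((k + d.+1) * D <= d.+1 * B * D)%N by rewrite -hE -mulnA leq_mul2l h2 orbT.
by move: h3; rewrite leq_pmul2r // /k; lia.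
Qed.

Lemma hilb_le d c c' N :
  (forall k, (N <= k)%N -> hilb d c k <= hilb d c' k) -> c 0%N <= c' 0%N.
Proof.
move=> h; rewrite -subr_ge0; apply: (@hilb_ge0 d (fun i => c' i - c i) N) => k hk.
have := h k hk; rewrite -subr_ge0 /hilb -sumrB.
by congr (0 <= _); apply: eq_bigr => i _; ring.
Qed.

(** The bound of [hilbert_bound] is itself of Hilbert form; the coefficient of index 1 is [- lam]
    because the form carries alternating signs. *)
Lemma hilb_bound d (t lam k : nat) :
  (lam * monom d.+1 k + t * monom d.+2 k)%N%:Z =
  hilb d.+1 (fun i => if i is i'.+1 then if i' is 0 then - lam%:Z else 0 else t%:Z) k.
Proof.
rewrite /hilb big_ord_recl big_ord_recl big1; last by move=> i _; rewrite mulr0 mul0r.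
rewrite !monomE /bump /= ?expr0 ?expr1 ?subn0 ?subn1 /= addr0 PoszD !PoszM; ring.
Qed.

(** * Colon ideals in a Buchsbaum ring *)

Section Buchsbaum.

Variable R : comPzRingType.
Implicit Types (A B C J G U : idl R) (x y z u w : R) (s : seq R).

Definition has_colength A l := ichain l A (top R) /\ length_le A (top R) l.

(** The dimension is an argument, so that two multiplicities can be compared as leading coefficients
    for the same [d]. *)
Definition has_mult A d (e : nat) := exists (c : nat -> int) (N : nat), c 0%N = e%:Z /\
  forall k, (N <= k)%N -> exists2 l, has_colength (powI A k.+1) l & l%:Z = hilb d c k.

(** The powers of [A] contain those of [gen (x :: s)], so [hilbert_bound] dominates the Hilbert
    polynomial of [A]; then leading coefficients are compared. *)
Lemma has_mult_le A U x s t lam e : sub (gen (x :: s)) A ->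
  (forall u, U u -> gen s (x * u)) -> length_le (addI U (gen (x :: s))) (top R) t ->
  length_le (gen (x :: s)) (top R) lam -> has_mult A (size s).+1 e -> (e <= t)%N.
Proof.
move=> hA hU ht hlam [c [N [c0 hc]]].
suff: c 0%N <= t%:Z by rewrite c0.
pose c' i : int := if i is i'.+1 then if i' is 0 then - lam%:Z else 0 else t%:Z.
apply: (@hilb_le (size s).+1 c c' N) => k hk.
have [l [hl _] <-] := hc k hk; rewrite -hilb_bound lez_nat.
by apply: (hilbert_bound hU ht hlam); apply: ichain_l hl; apply: powI_mono.
Qed.

Lemma has_mult_double x s d e e' : has_mult (gen (x :: s)) d e ->
  has_mult (gen (x ^+ 2 :: s)) d e' -> (e' <= 2 * e)%N.
Proof.
move=> [c [N [c0 hc]]] [c' [N' [c'0 hc']]].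
suff: c' 0%N <= 2 * c 0%N by rewrite c0 c'0; lia.
apply: (@hilb_le d c' (fun i => 2 * c i) (maxn N N')) => k; rewrite geq_max => /andP[hN hN'].
have [l [_ hl] lE] := hc k hN; have [l' [hl' _] <-] := hc' k hN'.
have -> : hilb d (fun i => 2 * c i) k = 2 * hilb d c k.
  by rewrite /hilb big_distrr /=; apply: eq_bigr => i _; ring.
by rewrite -lE -PoszM lez_nat; apply: (hilbert_double hl).
Qed.

Variable nn : idl R.
Hypothesis noeth : is_noetherian R.
Hypothesis hloc : @is_local R nn.

(* The list s generates an ideal of definition: it may have any length. *)
Definition defining s := (forall y, y \in s -> nn y) /\ exists K, sub (powI nn K) (gen s).

Lemma defining_sub s s' : defining s -> (forall y, y \in s' -> nn y) ->
  sub (gen s) (gen s') -> defining s'.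
Proof. by move=> [_ [K hK]] h hs; split=> //; exists K; apply: sub_trans hK hs. Qed.

Lemma defining_mem s s' : defining s -> (forall y, y \in s' -> nn y) ->
  (forall y, y \in s -> gen s' y) -> defining s'.
Proof. by move=> h h1 h2; apply: defining_sub h h1 _; apply: gen_min. Qed.

Lemma defining_perm s s' : s =i s' -> defining s -> defining s'.
Proof.
move=> h [h1 h2]; apply: (defining_mem (conj h1 h2)) => y; rewrite ?h //.
  by rewrite -h; apply: h1.
exact: gen_mem.
Qed.

(** By [pow_split] with [i = 0], the power [j.+1] of [gen (x :: s)] lies in
    [gen s + (x ^+ j.+1)]. *)
Lemma defining_pow x s j : (0 < j)%N -> defining (x :: s) -> defining (x ^+ j :: s).
Proof.
case: j => // j _ [h [K hK]]; split.
  move=> y; rewrite inE => /predU1P[->|ys]; last by apply: h; rewrite inE ys orbT.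
  by rewrite exprS; apply/idlMr/h/mem_head.
exists (K * j.+1)%N; apply: sub_trans (@powIM _ _ _ _) _.
apply: sub_trans (powI_mono hK) _.
move=> y; rewrite -[j.+1]add0n => /pow_split [y1 [_ [hy1 [y2 _ ->] ->]]].
apply: idlD; first by apply: gen_tl; move/mulI_subl: hy1 => /mulI_subl.
by apply/idlMr/gen_hd.
Qed.

(** Here [p.+1] plays the role of the dimension and [b] is the constant difference of length and
    multiplicity. *)
Variables (p : nat) (b : int).
Hypothesis hbuch : forall s, size s = p.+1 -> defining s ->
  exists l e : nat, [/\ has_colength (gen s) l, has_mult (gen s) p.+1 e & l%:Z - e%:Z = b].

(** Multiplication by [x ^+ j] identifies the layer with [R/((x) + (gen s : x ^+ j))], so a chain
    above that ideal bounds the length of the layer from below. *)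
Lemma colon_layer x s j G g :
  sub (addI (colon1 (gen s) (x ^+ j)) (scI x (top R))) G -> ichain g G (top R) ->
  ichain g (gen (x ^+ j.+1 :: s)) (gen (x ^+ j :: s)).
Proof.
move=> hG hg; have := @ichain_mul _ (gen (x ^+ j.+1 :: s)) (x ^+ j) G (top R) g _ hg.
move=> h; apply: ichain_r (h _).
  apply: addI_lub => [|_ [y _ ->]]; last by apply/idlMr/gen_hd.
  apply: gen_cons_min => [|y]; last exact: gen_tl.
  by rewrite exprS; apply/idlM/gen_hd.
move=> y [r [w [hw yE]]]; apply: hG.
exists (y - x * r), (x * r); split; [|by exists r|by ring].
by rewrite colon1E mulrBr yE exprSr; have -> : r * (x ^+ j * x) + w - x ^+ j * (x * r) = w by ring.
Qed.

(* Write g_j = l(R/((x) + (q : x^j))), with eventual value g_oo, and U = q : x^oo.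
   Then l(R/(q + (x^j))) = g_0 + ... + g_(j-1), so e(q + (x^2)) <= 2 e(q + (x)) gives
   g_1 <= e(q + (x)), and e(q + (x^j)) <= l(R/(U + (x^j))) = j g_oo for large j gives
   e(q + (x)) <= g_oo. Therefore g_1 = g_oo and U = (q : x) + x U. *)
Lemma colon_stable s x t : size s = p -> defining (x :: s) ->
  sub (colon1 (gen s) (x ^+ t)) (colon1 (gen s) x).
Proof.
move=> hs hx; set q := gen s.
have data j : exists h e, [/\ has_colength (gen (x ^+ j.+1 :: s)) h,
    has_mult (gen (x ^+ j.+1 :: s)) p.+1 e & h%:Z - e%:Z = b].
  by apply: hbuch; [rewrite /= hs|apply: defining_pow].
have [N hN] := stable_colon noeth q x.
have hcol m n : (m <= n)%N -> sub (colon1 q (x ^+ m)) (colon1 q (x ^+ n)).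
  by move=> hmn y; rewrite !colon1E -(subnK hmn) exprD -mulrA; apply: idlM.
set U := colon1 q (x ^+ N.+1).
have hU n : sub (colon1 q (x ^+ n)) U by apply: sub_trans (hN n) _; apply: hcol.
pose X := scI x (top R); pose G1 := addI (colon1 q x) X; pose Ginf := addI U X.
have hG : sub G1 Ginf by apply: addI_mono => //; apply: (hU 1%N).
have [h1 [e1 [[ch1 L1] m1 E1]]] := data 0%N.
have QG : sub (gen (x :: s)) G1.
  apply: gen_cons_min => [|y hy].
    by apply: addI_r; exists 1 => //; rewrite mulr1.
  by apply: addI_l; rewrite colon1E; apply: idlM.
have [g1 cg1 lg1] := length_le_max (@sub_top _ G1) (length_le_mono QG (@sub_refl _ _) L1).
have [gi cgi lgi] := length_le_max (@sub_top _ Ginf) (length_le_mono hG (@sub_refl _ _) lg1).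
have [h2 [e2 [[_ L2] m2 E2]]] := data 1%N.
have [ht [et [[_ Lt] mt Et]]] := data N.
have A2 : (g1 + h1 <= h2)%N.
  by apply: L2; apply: ichain_cat ch1; apply: colon_layer cg1; rewrite expr1.
have At : (N * gi + h1 <= ht)%N.
  apply: Lt; elim: (N) => [|n IH]; first by rewrite mul0n.
  rewrite mulSn -addnA; apply: ichain_cat IH; apply: colon_layer cgi.
  by apply: addI_mono.
have Ut j : length_le (addI U (gen (x ^+ j :: s))) (top R) (j * gi).
  elim: j => [|j IH].
    by apply: length_le_sub0; apply: top1; apply: addI_r; rewrite expr0; apply: gen_hd.
  set A := addI U _.
  have hA : sub A (addI A (scI (x ^+ j) (top R))) by move=> y; apply: addI_l.
  rewrite mulSn; apply: (length_le_add hA (@sub_top _ _)).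
    apply: length_le_mul lgi => // _ [u [_ [Uu [r _ ->] ->]]]; rewrite mulrDr.
    apply: idlD; first by apply/addI_l/idlM.
    by apply: addI_r; rewrite mulrA -exprSr; apply/idlMr/gen_hd.
  apply: (length_le_mono _ _ IH) => //.
  apply: addI_lub => [y Uy|]; first by do 2!apply: addI_l.
  apply: gen_cons_min => [|y hy].
    by apply: addI_r; exists 1 => //; rewrite mulr1.
  by apply: addI_l; apply: addI_r; apply: gen_tl.
have Bt : (et <= N.+1 * gi)%N.
  by apply: (has_mult_le (@sub_refl _ _) _ (Ut N.+1) Lt); rewrite ?hs.
have B2 := has_mult_double m1 m2.
(* As [h - e] is constant, [A2] and [B2] give [g1 <= e2 - e1 <= e1], while [At] and [Bt] give
   [N * gi <= et - e1 <= N.+1 * gi - e1], that is [e1 <= gi]. *)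
have g1i : (g1 <= gi)%N by rewrite mulSn in Bt; lia.
have GG : sub Ginf G1 by apply: (length_le_eq hG (length_le_le g1i lg1) cgi).
(* Iterating [U = (q : x) + x U] gives [U = (q : x) + x ^+ n U]; for [n = N.+1] the second summand
   lies in [q]. *)
have iter_ u n : U u -> exists v r, [/\ q (x * v), U r & u = v + x ^+ n * r].
  move=> Uu; elim: n => [|n [v [r [hv Ur uE]]]].
    by exists 0, u; split=> //; [rewrite mulr0; apply: idl0|rewrite expr0 mul1r add0r].
  have [v' [_ [hv' [r' _ ->] rE]]] : G1 r by apply: GG; apply: addI_l.
  exists (v + x ^+ n * v'), r'; split; last by rewrite uE rE exprSr; ring.
    by rewrite mulrDr mulrCA; apply: idlD => //; apply: idlM.
  apply: (hU N.+2); rewrite colon1E exprSr -mulrA.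
  have -> : x * r' = r - v' by rewrite rE addrC addKr.
  by rewrite mulrBr; apply: idlB => //; apply: (hU 1%N v'); rewrite colon1E expr1.
move=> u /hU Uu; rewrite colon1E.
have [v [r [hv Ur ->]]] := iter_ u N.+1 Uu.
by rewrite mulrDr; apply: idlD => //; apply: idlM.
Qed.

(* Since R/(q + (x)) has finite length, x^M z^k = c z^(k+1) modulo q for some k and M;
   the element y = x^M - c z then satisfies z^k y = 0 modulo q. *)
Lemma parameter_switch s x z : size s = p -> defining (x :: s) -> nn z ->
  exists y, defining (z + x * y :: s).
Proof.
move=> hs hx hz.
pose A k := gen (z ^+ k :: s).
have /choice[m hm] : forall k, exists m, forall n,
  sub (colon1 (A k) (x ^+ n)) (colon1 (A k) (x ^+ m)) by move=> k; apply: stable_colon.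
pose D k := colon1 (A k) (x ^+ m k).
have xD k r : D k (x * r) -> D k r.
  by move=> h; apply: (hm k (m k).+1); rewrite colon1E exprSr -mulrA.
have AA k : sub (A k.+1) (A k).
  apply: gen_cons_min => [|y]; last exact: gen_tl.
  by rewrite exprS; apply/idlM/gen_hd.
have DD k : sub (D k.+1) (D k).
  by move=> y hy; apply: (hm k (m k.+1)); rewrite colon1E; apply/AA/hy.
have Dq k : sub (gen s) (D k) by move=> y hy; rewrite colon1E; apply/idlM/gen_tl.
pose P k := addI (D k) (gen [:: x]).
(* The [P k] decrease and contain [gen (x :: s)], which has finite colength, so they cannot all be
   distinct. *)
have [k hk] : exists k, sub (P k) (P k.+1).
  apply: contrapT => h.
  have hP k : ichain k (P k) (top R).
    elim: k => [|k IH] //; exists (P k); split=> //; first exact: addI_mono.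
    by move=> h'; apply: h; exists k.
  have [l [_ [[_ L] _ _]]] := hbuch (s := x :: s) (congr1 S hs) hx.
  have: (l.+1 <= l)%N; last by rewrite ltnn.
  apply: L; apply: ichain_l (hP l.+1); apply: gen_cons_min => [|y hy].
    by apply: addI_r; apply: gen_hd.
  by apply: addI_l; apply: Dq.
have Dz : D k (z ^+ k) by rewrite colon1E; apply/idlM/gen_hd.
have iter_ t : exists v r, [/\ D k.+1 v, D k r & z ^+ k = v + x ^+ t * r].
  elim: t => [|t [v [r [Dv Dr zE]]]].
    by exists 0, (z ^+ k); split=> //; [apply: idl0|rewrite expr0 mul1r add0r].
  have [v' [_ [Dv' [r' [_ [-> ->]]] rE]]] := hk r (addI_l _ Dr).
  rewrite addr0 in rE; exists (v + x ^+ t * v'), r'; split.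
  - by apply: idlD => //; apply: idlM.
  - apply: xD; have -> : x * r' = r - v' by rewrite rE; ring.
    by apply: idlB => //; apply: DD.
  - by rewrite zE rE exprSr; ring.
have nx : nn x by have [h _] := hx; apply: h; apply: mem_head.
(* Since [x ^+ m k * r] is [c * z ^+ k] modulo [gen s], taking [t = (m k).+1] puts
   [(1 - x * c) * z ^+ k] in [D k.+1], and [1 - x * c] is a unit. *)
have Dz1 : D k.+1 (z ^+ k).
  have [v [r [Dv Dr zE]]] := iter_ (m k).+1.
  have [c [w [hw rE]]] : A k (x ^+ m k * r) by [].
  have [u hu] := unit_1B noeth hloc (idlMr c nx).
  rewrite -[z ^+ k]mul1r -hu -mulrA; apply: idlM.
  have -> : (1 - x * c) * z ^+ k = v + x * w.
    by rewrite mulrBl mul1r {1}zE exprS -mulrA rE; ring.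
  by apply: idlD => //; apply/idlM/Dq.
have [c [w [hw zE]]] : A k.+1 (x ^+ m k.+1 * z ^+ k) by [].
pose y := x ^+ m k.+1 - c * z; exists y; set w0 := z + x * y.
have yz : gen s (z ^+ k * y).
  by rewrite mulrBr mulrC zE exprS; have -> : c * (z * z ^+ k) + w - z ^+ k * (c * z) = w by ring.
have nw0 : nn w0 by apply: idlD => //; apply: idlMr.
have ns v : v \in s -> nn v by case: hx => h _ vs; apply: h; rewrite inE vs orbT.
have h1 : defining (z :: w0 :: s).
  apply: (defining_mem (defining_pow (ltn0Sn (m k.+1)) hx)) => v.
    by rewrite !inE => /or3P[/eqP->|/eqP->|/ns].
  rewrite inE => /predU1P[->|vs]; last by do 2!apply: gen_tl; apply: gen_mem.
  have -> : x ^+ (m k.+1).+1 = (c * x - 1) * z + w0.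
    by rewrite exprS /w0 /y; ring.
  by apply: idlD; [apply/idlM/gen_hd|apply/gen_tl/gen_hd].
apply: (defining_mem (defining_pow (ltn0Sn k) h1)) => v.
  by rewrite inE => /predU1P[->|/ns].
rewrite inE => /predU1P[->|]; last exact: gen_mem.
have -> : z ^+ k.+1 = z ^+ k * w0 - x * (z ^+ k * y) by rewrite exprSr /w0; ring.
by apply: idlB; [apply/idlM/gen_hd|apply/idlM/gen_tl].
Qed.

(** With [w = z + x * y] from [parameter_switch], some power of [w] lies in [gen (x :: s)] and so
    multiplies [u] into [gen s]. By [colon_stable] already [w * u] lies there, and [z * u] differs
    from it by [y * (x * u)]. *)
Lemma colon_nn s x z u : size s = p -> defining (x :: s) -> nn z ->
  gen s (x * u) -> gen s (z * u).
Proof.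
move=> hs hx hz hu; have [y hw] := parameter_switch hs hx hz.
set w := z + x * y in hw.
have nw : nn w by case: hw => h _; apply: h; apply: mem_head.
have -> : z * u = w * u - y * (x * u) by rewrite /w; ring.
apply: idlB; last exact: idlM.
have [_ [K hK]] := hx.
apply: (colon_stable (t := K) hs hw); rewrite colon1E.
have [r [v [hv ->]]] := hK _ (powI_exp K nw).
by rewrite mulrDl -mulrA; apply: idlD; [apply: idlM|apply: idlMr].
Qed.

(* By colon_nn, z u lies in gen (x ^+ k :: s) for every k. *)
Lemma colon_nn_lower s a x z u : (size s).+1 = p -> defining (x :: a :: s) -> nn z ->
  gen s (a * u) -> gen s (z * u).
Proof.
move=> hs hx hz hu.
have nx : nn x by case: hx => h _; apply: h; apply: mem_head.
apply: (bigcap_pow noeth hloc nx) => k.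
have h1 : defining (a :: x ^+ k.+1 :: s).
  by apply: defining_perm (defining_pow (ltn0Sn k) hx) => v; rewrite !inE orbCA.
have [r [w [hw ->]]] := colon_nn (s := x ^+ k.+1 :: s) hs h1 hz (@gen_tl _ _ _ _ hu).
exists (x * r); rewrite exprSr.
by have -> : r * (x ^+ k * x) + w - x ^+ k * (x * r) = w by ring.
Qed.

Variable e : nat.
Hypotheses (he : has_mult nn p.+1 e) (he1 : (1 < e)%N).

(* The multiplicity of nn is at most that of gen (x :: s), which the inclusion would
   bound by l(R/nn) = 1. With x = 0 this says that p elements never generate an
   ideal of definition. *)
Lemma no_small_multiplicity s x U : size s = p -> defining (x :: s) ->
  (forall u, U u -> gen s (x * u)) -> ~ sub nn (addI U (gen (x :: s))).
Proof.
move=> hs hx hU hn.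
have [l [_ [[_ L] _ _]]] := hbuch (s := x :: s) (congr1 S hs) hx.
have hsub : sub (gen (x :: s)) nn by apply: gen_min; case: hx.
have hlle := length_le_mono hn (@sub_refl _ _) (length_le_nn hloc).
have := he; rewrite -hs => he'; have := has_mult_le hsub hU hlle L he'.
by rewrite leqNgt he1.
Qed.

End Buchsbaum.

(** * Products of elements of the socle ideal *)

Section SocleSquare.

Variables (R : comPzRingType) (nn : idl R) (p : nat) (b : int) (e : nat).
Hypothesis noeth : is_noetherian R.
Hypothesis hloc : @is_local R nn.
Hypothesis hbuch : forall s : seq R, size s = p.+1 -> defining nn s ->
  exists l e : nat, [/\ has_colength (gen s) l, has_mult (gen s) p.+1 e & l%:Z - e%:Z = b].
Hypotheses (he : has_mult nn p.+1 e) (he1 : (1 < e)%N).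

Variables (a : 'I_p -> R) (g h : R).
Let s := [seq a i | i <- enum 'I_p].
Let q := gen s.
Let QQ := gen (g * h :: s).
Hypotheses (ng : nn g) (nh : nn h) (hprim : defining nn (g * h :: s)).
Let U := colon q nn.
Let J := colon QQ nn.

Let size_s : size s = p. Proof. by rewrite size_map size_enum_ord. Qed.
Let ns y : y \in s -> nn y.
Proof. by case: hprim => H _ ys; apply: H; rewrite inE ys orbT. Qed.

Let defining_factor x y : nn x -> QQ = gen (x * y :: s) -> defining nn (x :: s).
Proof.
move=> nx E; apply: (defining_sub hprim) => [v|]; first by rewrite inE => /predU1P[->|/ns].
rewrite -/QQ E; apply: gen_cons_min => [|v]; last exact: gen_tl.
by apply/idlMr/gen_hd.
Qed.
Let defining_g : defining nn (g :: s). Proof. exact: (defining_factor (y := h)). Qed.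
Let defining_h : defining nn (h :: s).
Proof. by apply: (defining_factor (y := g)) => //; rewrite mulrC. Qed.

Let U_of x u : defining nn (x :: s) -> q (x * u) -> U u.
Proof.
move=> hx hu z nz; rewrite mulrC.
exact: (colon_nn noeth hloc hbuch size_s hx nz hu).
Qed.
Let Uq u z : U u -> nn z -> q (z * u). Proof. by rewrite mulrC => hu /hu. Qed.

Let qP y : q y <-> exists u : 'I_p -> R, y = \sum_i u i * a i.
Proof.
rewrite /q /s gen_coef ?enum_uniq //.
by split=> -[u ->]; exists u; rewrite big_enum.
Qed.

Let rest i := [seq a j | j <- enum (predC1 i)].
Let size_rest i : (size (rest i)).+1 = p.
Proof. by rewrite size_map -cardE cardC1 card_ord prednK //; apply: leq_ltn_trans (ltn_ord i). Qed.
Let s_rest i : s =i a i :: rest i.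
Proof.
move=> y; rewrite inE; apply/mapP/predU1P.
  move=> [j _ ->]; case: (eqVneq j i) => [->|ji]; [by left|right].
  by apply: map_f; rewrite mem_enum.
by move=> [->|/mapP [j _ ->]]; [exists i|exists j]; rewrite ?mem_enum.
Qed.
Let rest_q i y : gen (rest i) y -> q y.
Proof.
by apply: gen_min => {}y hy; apply: gen_mem; rewrite (s_rest i) inE hy orbT.
Qed.

(** The relation puts [a i * t i] in the ideal of the other [a j]; [colon_nn_lower] applies, with
    [g] as the completing parameter. *)
Let syzygy (t : 'I_p -> R) z i : \sum_j t j * a j = 0 -> nn z -> gen (rest i) (z * t i).
Proof.
move=> ht nz.
have hx : defining nn (g :: a i :: rest i).
  by apply: defining_perm defining_g => y; rewrite !inE (s_rest i) inE.
apply: (colon_nn_lower noeth hloc hbuch (size_rest i) hx nz).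
rewrite (bigD1 i) //= in ht.
have -> : a i * t i = - \sum_(j | j != i) t j * a j.
  by rewrite mulrC; apply/eqP; rewrite -addr_eq0 ht.
apply/idlN/idl_sum => j ji; apply/idlM/gen_mem/map_f.
by rewrite mem_enum.
Qed.

Let syzygy2 (t t' : 'I_p -> R) z i :
  \sum_j t j * a j = \sum_j t' j * a j -> nn z -> gen (rest i) (z * (t i - t' i)).
Proof.
move=> E; apply: (syzygy (t := fun j => t j - t' j)).
transitivity (\sum_j t j * a j - \sum_j t' j * a j); last by rewrite E subrr.
by rewrite -sumrB; apply: eq_bigr => j _; ring.
Qed.

Let no_small := no_small_multiplicity hloc hbuch he he1.

(** A unit in [J] would put [nn] inside [QQ], against [no_small_multiplicity]. *)
Let J_nn x : J x -> nn x.
Proof.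
move=> Jx; apply: contrapT => /(unit_ex noeth hloc) [u ux].
apply: (no_small (U := q) size_s hprim) => [v hv|y ny]; first exact: idlM.
by apply: addI_r; rewrite -[y]mul1r -ux -mulrA; apply/idlM/Jx.
Qed.

Let U_J u : U u -> J u.
Proof. by move=> Uu y ny; apply: gen_tl; apply: Uu. Qed.

(** Write [w * w'] with coefficients [y] and [g * w] with coefficients [u]. Two expansions of
    [g * w * w'] make [g * y i] and [u i * w'] agree up to a syzygy, so [g ^+ 2 * y i] lies in [q]
    and [y i] in [U]. *)
Let socle_mul_UU w w' : U w -> U w' -> mulI q J (w * w').
Proof.
move=> Uw Uw'.
have /qP [y yE] := Uw w' (J_nn (U_J Uw')).
have /qP [u uE] := Uq Uw ng.
rewrite yE; under eq_bigr do rewrite mulrC.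
apply: mulI_bigsub => i; first by apply: gen_mem; rewrite (s_rest i) mem_head.
apply/U_J/(U_of (x := g ^+ 2)); first exact: defining_pow.
have E : \sum_j g * y j * a j = \sum_j u j * w' * a j.
  transitivity (g * (w * w')).
    by rewrite yE big_distrr /=; apply: eq_bigr => j _; ring.
  by rewrite mulrA uE big_distrl /=; apply: eq_bigr => j _; ring.
have -> : g ^+ 2 * y i = g * (g * y i - u i * w') + u i * (g * w') by ring.
by apply: idlD; [apply/(rest_q (i := i))/(syzygy2 i E)|apply/idlM/Uq].
Qed.

(** If [u i] were a unit, comparing two expansions of [g * (y * w)] would write each [y] in [nn] as
    a multiple of [g] plus an element of [gen (rest i) : nn]. Then the [p] elements [g :: rest i]
    would generate an ideal containing the square of [nn]. *)
Let coef_nn w (u : 'I_p -> R) i : U w -> g * w = \sum_j u j * a j -> nn (u i).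
Proof.
move=> Uw uE; apply: contrapT => /(unit_ex noeth hloc) [v vE].
have hy y : nn y -> exists r t, y = r * g + t /\ forall z, nn z -> gen (rest i) (z * t).
  move=> ny; have /qP [c cE] := Uq Uw ny.
  have E : \sum_j u j * y * a j = \sum_j g * c j * a j.
    transitivity (g * (y * w)).
      by rewrite mulrCA uE big_distrr /=; apply: eq_bigr => j _; ring.
    by rewrite cE big_distrr /=; apply: eq_bigr => j _; ring.
  exists (v * c i), (v * (u i * y - g * c i)); split.
    rewrite -[y in LHS]mul1r -vE; ring.
  by move=> z nz; rewrite mulrCA; apply/idlM/(syzygy2 i E).
(* The entry 0 pads the list to [p.+1] elements, so that [U] may be taken to be the whole ring. *)
have h0 : defining nn (0 :: g :: rest i).
  have nr y : y \in rest i -> nn y by move=> hr; apply: ns; rewrite (s_rest i) inE hr orbT.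
  split=> [y|]; first by rewrite !inE => /or3P[/eqP->|/eqP->|/nr //]; rewrite //; apply: idl0.
  exists 2%N; apply: mulI_min => x y /hy [r [t [-> ht]]] /mulI_subl ny.
  apply: gen_tl; rewrite mulrDl; apply: idlD; first by apply/idlMr/idlM/gen_hd.
  by apply: gen_tl; rewrite mulrC; apply: ht.
have hs : size (g :: rest i) = p by rewrite /= size_rest.
apply: (no_small (U := top R) hs h0) => [x _|x _]; first by rewrite mul0r; apply: idl0.
exact: addI_l.
Qed.

(** Cancelling [g] modulo [q] gives [t] and [v]. For [y] in [nn] with data [t'], [v'], the element
    [h * (y * t - z * t') = z * v' - y * v] lies in [q]. So a unit [t] would force
    [nn = (z) + U]. *)
Let colon_quot c z : J (g * c) -> nn z -> exists t v, [/\ nn t, U v & z * c = h * t + v].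
Proof.
move=> Jc.
have hz y : nn y -> exists t v, U v /\ y * c = h * t + v.
  move=> ny; have [r [w [hw E]]] := Jc y ny; exists r, (y * c - h * r); split; last by ring.
  apply: (U_of defining_g); rewrite mulrBr.
  have -> : g * (y * c) - g * (h * r) = g * c * y - r * (g * h) by ring.
  by rewrite E addrC addKr.
move=> nz; have [t [v [Uv vE]]] := hz z nz; exists t, v; split=> //.
apply: contrapT => /(unit_ex noeth hloc) [u ut].
have hy y : nn y -> exists r w, U w /\ y = r * z + w.
  move=> ny; have [t' [v' [Uv' v'E]]] := hz y ny.
  exists (u * t'), (u * (y * t - z * t')); split; last first.
    by rewrite -[y in LHS]mul1r -ut; ring.
  apply: idlM; apply: (U_of defining_h).
  have -> : h * (y * t - z * t') = z * v' - y * v.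
    have -> : v' = y * c - h * t' by rewrite v'E addrC addKr.
    have -> : v = z * c - h * t by rewrite vE addrC addKr.
    by ring.
  by apply: idlB; apply: Uq.
have hzp : defining nn (z :: s).
  split=> [y|]; first by rewrite inE => /predU1P[->|/ns].
  exists 2%N; apply: mulI_min => x y /hy [r [w [Uw ->]]] /mulI_subl ny.
  rewrite mulrDl; apply: idlD; first by apply/idlMr/idlM/gen_hd.
  by apply: gen_tl; apply: Uw.
apply: (no_small (U := U) size_s hzp) => [x Ux|y /hy [r [w [Uw ->]]]]; first exact: Uq.
by rewrite addrC; apply: idlD; [apply: addI_l|apply/addI_r/idlM/gen_hd].
Qed.

(** The coefficients [u i * c] lie in [J]: in [u i * c * z = h * t * u i + u i * v], a syzygy
    replaces [t * u i] by [g * u' i], producing a multiple of [g * h], and [u i * v] is in [q] by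
    [coef_nn]. *)
Let socle_mul_Ug w c : U w -> J (g * c) -> mulI q J (w * (g * c)).
Proof.
move=> Uw Jc; have /qP [u uE] := Uq Uw ng.
have -> : w * (g * c) = \sum_i a i * (u i * c).
  transitivity (g * w * c); first by ring.
  by rewrite uE big_distrl /=; apply: eq_bigr => i _; ring.
apply: mulI_bigsub => i; first by apply: gen_mem; rewrite (s_rest i) mem_head.
move=> z nz; have [t [v [nt Uv E]]] := colon_quot Jc nz.
have /qP [u' u'E] := Uq Uw nt.
have E' : \sum_j t * u j * a j = \sum_j g * u' j * a j.
  transitivity (t * (g * w)).
    by rewrite uE big_distrr /=; apply: eq_bigr => j _; ring.
  by rewrite mulrCA u'E big_distrr /=; apply: eq_bigr => j _; ring.
have -> : u i * c * z = u' i * (g * h) + (h * (t * u i - g * u' i) + u i * v).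
  transitivity (u i * (z * c)); first by ring.
  by rewrite E; ring.
exists (u' i), (h * (t * u i - g * u' i) + u i * v); split=> //.
apply: (@idlD _ q); first exact/(rest_q (i := i))/(syzygy2 i E').
exact/Uq/(coef_nn i Uw uE).
Qed.

(** As [h] is in [nn], [x * h] is [r * g * h] modulo [q], and cancelling [h] puts [x - g * r] in
    [U]. *)
Let socle_split x : J x -> exists c w, [/\ J (g * c), U w & x = g * c + w].
Proof.
move=> Jx; have [r [y [hy E]]] := Jx h nh.
have Uw : U (x - g * r).
  apply: (U_of defining_h); have -> : h * (x - g * r) = x * h - r * (g * h) by ring.
  by rewrite E addrC addKr.
exists r, (x - g * r); split=> //; last by ring.
have -> : g * r = x - (x - g * r) by ring.
by apply: idlB => //; apply: U_J.
Qed.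

Lemma socle_square x x' : J x -> J x' ->
  exists k y, mulI q J y /\ x * x' = g * h * k + y.
Proof.
move=> /socle_split [c [w [Jc Uw ->]]] /socle_split [c' [w' [Jc' Uw' ->]]].
have [t [v [nt Uv E]]] := colon_quot Jc ng.
exists (t * c'), (v * (g * c') + (w' * (g * c) + (w * (g * c') + w * w'))); split.
  by do 3?apply: idlD; [exact: socle_mul_Ug..|exact: socle_mul_UU].
transitivity (g * c * (g * c') + (w' * (g * c) + (w * (g * c') + w * w'))); first by ring.
by rewrite {1}E; ring.
Qed.

End SocleSquare.

(** * Transfer of chains, dimension and length along quotients *)

Lemma has_chain_map (T T' : Type) (P : set (set T)) (P' : set (set T'))
    (phi : set T -> set T') l :
  (forall C, P C -> P' (phi C)) ->
  (forall C D, P C -> P D -> C `<=` D -> phi C `<=` phi D) ->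
  (forall C D, P C -> P D -> C `<=` D -> phi D `<=` phi C -> D `<=` C) ->
  has_chain P l -> has_chain P' l.
Proof.
move=> hP hm hr [C [hC hlt]]; exists (phi \o C); split=> [i /hC/hP //|i il].
have [CD DC] := hlt i il; have [Pi Pj] := (hC i (ltnW il), hC i.+1 il).
by split; [apply: hm|move=> /(hr _ _ Pi Pj CD)].
Qed.

Lemma has_chain_le (T : Type) (P : set (set T)) l m :
  (m <= l)%N -> has_chain P l -> has_chain P m.
Proof.
move=> ml [C [hC hlt]]; exists C; split=> i im; first by apply/hC/(leq_trans im).
by apply/hlt/(leq_trans im).
Qed.

Lemma max_chain_uniq (T : Type) (P : set (set T)) l l' :
  max_chain P l -> max_chain P l' -> l = l'.
Proof.
move=> [h1 h2] [h1' h2']; case: (ltngtP l l') => // ll.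
  by case: h2; apply: has_chain_le ll h1'.
by case: h2'; apply: has_chain_le ll h1.
Qed.

Section QuotientTransfer.

Variables (R : comPzRingType) (S : set R).
Local Notation pi := (quot_pi S).

Lemma quot_pi_mul (x y : R) : pi (x * y) = pi x * pi y.
Proof. exact: quot_piM. Qed.
Lemma quot_pi0 : pi 0 = 0.
Proof. by apply: (addrI (pi 0)); rewrite -quot_piD !addr0. Qed.
Lemma quot_pi_surj (X : quot S) : exists x, X = pi x.
Proof. by exists (quot_repr X); rewrite quot_reprK. Qed.

Lemma preim_ideal (B : idl (quot S)) : @is_ideal R [set x | B (pi x)].
Proof.
split=> [|x y|r x] /=; first by rewrite quot_pi0; apply: idl0.
  by rewrite quot_piD; apply: idlD.
by rewrite quot_pi_mul; apply: idlM.
Qed.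
Definition preim (B : idl (quot S)) := Idl (preim_ideal B).

Lemma im_ideal (A : idl R) : @is_ideal (quot S) [set X | exists2 x, A x & X = pi x].
Proof.
split; first by exists 0; [apply: idl0|rewrite quot_pi0].
  by move=> _ _ [x Ax ->] [y Ay ->]; exists (x + y); rewrite ?quot_piD //; apply: idlD.
move=> X _ [x Ax ->]; have [r ->] := quot_pi_surj X.
by exists (r * x); rewrite ?quot_pi_mul //; apply: idlM.
Qed.
Definition im (A : idl R) := Idl (im_ideal A).

Lemma im_pi (A : idl R) x : (forall y, S y -> A y) -> im A (pi x) -> A x.
Proof.
move=> hS [y Ay /quot_pi_eq /(genI_min hS) hxy].
by rewrite -(subrK y x); apply: idlD.
Qed.

(** The correspondence theorem at the level of chains; the third condition says that the sets in [P]
    are unions of fibres of [pi]. *)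
Lemma has_chain_quot (P : set (set R)) (P' : set (set (quot S))) l :
  (forall C, P' C -> P [set x | C (pi x)]) ->
  (forall I, P I -> P' [set X | exists2 x, I x & X = pi x]) ->
  (forall I, P I -> forall x y, I y -> pi x = pi y -> I x) ->
  has_chain P' l <-> has_chain P l.
Proof.
move=> h1 h2 h3; split.
  apply: (has_chain_map (phi := fun C => [set x | C (pi x)])) => //.
    by move=> C D _ _ h x; apply: h.
  by move=> C D _ _ _ h X; have [x ->] := quot_pi_surj X; apply: h.
apply: (has_chain_map (phi := fun C => [set X | exists2 x, C x & X = pi x])) => //.
  by move=> C D _ _ h X [x /h ? ->]; exists x.
move=> C D PC _ _ h x Dx; have [|y Cy E] := h (pi x); first by exists x.
exact: h3 Cy E.
Qed.

Lemma prime_quot l : has_chain (@is_prime (quot S)) l <->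
  has_chain [set P | @is_prime R P /\ S `<=` P] l.
Proof.
apply: has_chain_quot.
- move=> C [Ci C1 CM]; split; last first.
    move=> x Sx /=; have -> : pi x = 0; last by have [] := Ci.
    rewrite -quot_pi0; apply/quot_pi_eq; rewrite subr0.
    exact: genI_sub.
  split; [exact: (preim_ideal (Idl Ci))|exact: C1|].
  by move=> x y /=; rewrite quot_pi_mul; apply: CM.
- move=> I [[Ii I1 IM] SI]; split; first exact: (im_ideal (Idl Ii)).
    by move=> h; apply: I1; apply: (@im_pi (Idl Ii)) h.
  move=> X Y; have [x ->] := quot_pi_surj X; have [y ->] := quot_pi_surj Y.
  rewrite -quot_pi_mul => /(@im_pi (Idl Ii) _ SI) /IM [Ix|Iy].
    by left; exists x.
  by right; exists y.
move=> I [[Ii _ _] SI] x y Iy E; apply: (@im_pi (Idl Ii)) => //.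
by exists y.
Qed.

End QuotientTransfer.

(** For [n > 0] a prime contains [f ^+ n] exactly when it contains [f]. *)
Lemma krull_dim_quot_exp (R : comPzRingType) (f : R) n d : (0 < n)%N ->
  krull_dim (quot [set f]) d -> krull_dim (quot [set f ^+ n]) d.
Proof.
move=> n0.
suff E l : has_chain (@is_prime (quot [set f ^+ n])) l <->
           has_chain (@is_prime (quot [set f])) l.
  by rewrite /krull_dim /max_chain -!E.
rewrite !prime_quot.
suff -> : [set P | @is_prime R P /\ [set f ^+ n] `<=` P] =
          [set P | @is_prime R P /\ [set f] `<=` P] by [].
apply/seteqP; split=> P [hP hf]; split=> // _ ->.
  have [[_ _ _] P1 PM] := hP; have := hf _ erefl.
  elim: {n0 hf} n => [|n IH]; first by rewrite expr0.
  by rewrite exprS => /PM [].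
have [[_ _ PM] _ _] := hP; case: n n0 => // n _.
by rewrite exprSr; apply: PM; apply: hf.
Qed.

Section LengthTransfer.

Variable R : comPzRingType.
Implicit Types A B : idl R.

Definition over A := [set J : set R | @is_ideal R J /\ (A : set R) `<=` J].

(** A chain in [over A] may start strictly above [A]; replacing its first term by [A] keeps every
    step strict. *)
Lemma ichain_chain A l : ichain l A (top R) <-> has_chain (over A) l.
Proof.
split.
  move=> h; suff [C [C0 hC hlt]] : exists C : nat -> set R, [/\ C 0%N = A,
      (forall i, (i <= l)%N -> @is_ideal R (C i)) &
      (forall i, (i < l)%N -> C i `<` C i.+1)].
    exists C; split=> // i il; split; first exact: hC.
    elim: i il => [|i IH] il; first by rewrite C0.
    by apply: subset_trans (IH (ltnW il)) _; have [] := hlt i il.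
  elim: l A h => [|l IH] A.
    by move=> _; exists (fun=> A : set R); split=> // i _; apply: carP.
  move=> [B [AB BA /IH [C [C0 hC hlt]]]].
  exists (fun i => if i is i'.+1 return set R then C i' else A); split=> //.
    by case=> [|i] il; [apply: carP|apply: hC].
  by case=> [|i] il; [rewrite C0; split|apply: hlt].
move=> [C [hC hlt]]; have [_ A0] := hC 0%N (leq0n _).
elim: l C A {hC A0}(fun i il => (hC i il).1) hlt A0 => [|l IH] C A hC hlt A0 //.
have [C01 C10] := hlt 0%N (ltn0Sn _).
exists (Idl (hC 1%N isT)); split.
- by move=> x /A0 /C01.
- by move=> h; apply: C10 => x /h /A0.
by apply: (IH (fun i => C i.+1)) => // i il; [apply: hC|apply: hlt].
Qed.

Lemma submodule_quot A l : has_chain (@is_submodule R (quot A)) l <-> has_chain (over A) l.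
Proof.
apply: has_chain_quot.
- move=> C [C0 CD CM]; split; first split.
  + by rewrite /= quot_pi0.
  + by move=> x y /=; rewrite quot_piD; apply: CD.
  + by move=> r x /= /(CM r); rewrite /= quot_pi_mul.
  move=> x Ax /=; have -> // : quot_pi A x = 0.
  by rewrite -quot_pi0; apply/quot_pi_eq; rewrite subr0; apply: genI_sub.
- move=> I [Ii _]; have [h0 hD hM] := @im_ideal R A (Idl Ii); split=> //.
  by move=> r X; apply: hM.
by move=> I [Ii SI] x y Iy E; apply: (@im_pi R A (Idl Ii)) => //; exists y.
Qed.

Lemma module_length_colength A l : @module_length R (quot A) l -> has_colength A l.
Proof.
rewrite /module_length /max_chain !submodule_quot -!ichain_chain => -[h1 h2]; split=> // m hm.
by rewrite leqNgt; apply/negP => lm; apply/h2/(ichain_le lm).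
Qed.

Lemma ideal_exp_powI A k : ideal_exp A k = (powI A k : set R).
Proof. by rewrite /ideal_exp; elim: k => [|k IH] //=; rewrite IH. Qed.

Lemma multiplicity_has_mult A d e : krull_dim R d -> multiplicity A e -> has_mult A d e.
Proof.
move=> hd [d' [c [N [/(max_chain_uniq hd) <- c0 hc]]]]; exists c, N; split=> // k hk.
have [l hl E] := hc k hk; exists l => //.
by move: hl; rewrite ideal_exp_powI; apply: module_length_colength.
Qed.

Lemma gen_range d (x : 'I_d -> R) :
  (gen [seq x i | i <- enum 'I_d] : set R) = ideal_gen (range x).
Proof.
apply/seteqP; split.
  by apply: (@gen_min _ _ (genI (range x))) => _ /mapP [i _ ->]; apply: genI_sub; exists i.
by apply: genI_min => _ [i _ <-]; apply/gen_mem/map_f; rewrite mem_enum.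
Qed.

Lemma defining_parameter (nn : idl R) s : krull_dim R (size s) -> defining nn s ->
  parameter_ideal nn (gen s).
Proof.
move=> hd [h1 [K hK]]; exists (size s), (fun i => nth 0 s i); split=> //.
- rewrite -gen_range; congr (gen _ : set R).
  apply: (@eq_from_nth _ 0); first by rewrite size_map size_enum_ord.
  move=> i il; rewrite (nth_map (Ordinal il)) ?size_enum_ord //.
  by rewrite nth_enum_ord.
- exact: gen_min.
by exists K; rewrite ideal_exp_powI.
Qed.

End LengthTransfer.

(** * Lifting a parameter ideal from [R/(f^n)] to [R] *)

Lemma buchsbaum_lengths (R : comPzRingType) (nn : idl R) p :
  is_buchsbaum nn -> krull_dim R p.+1 ->
  exists b : int, forall s : seq R, size s = p.+1 -> defining nn s ->
    exists l e : nat, [/\ has_colength (gen s) l, has_mult (gen s) p.+1 e & l%:Z - e%:Z = b].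
Proof.
move=> [_ _ _ [b hb]] hd; exists b => s hs hp.
have [|l [e [hl he E]]] := hb (gen s); first by apply: defining_parameter; rewrite ?hs.
exists l, e; split=> //; first exact: module_length_colength.
exact: multiplicity_has_mult.
Qed.

(** Elements outside [nn] are units, so their images avoid [m]; conversely the image of [nn] is a
    proper ideal containing [m], hence equal to it. *)
Lemma preim_maximal (R : comPzRingType) (nn : idl R) (S : set R) (m : set (quot S)) x :
  is_noetherian R -> @is_local R nn -> S `<=` nn -> is_maximal m ->
  m (quot_pi S x) <-> nn x.
Proof.
move=> noeth hloc hS [mi m1 mmax].
have sub1 y : m (quot_pi S y) -> nn y.
  move=> my; apply: contrapT => /(unit_ex noeth hloc) [u uy].
  by apply: m1; have := idlM (quot_pi S u) (my : Idl mi _); rewrite -quot_pi_mul uy.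
split; first exact: sub1.
move=> nx; rewrite -(mmax (im S nn)); [by exists x|exact: carP| |].
  by move=> /(@im_pi R S nn 1 hS); apply: (nn1 hloc).
by move=> X; have [y ->] := quot_pi_surj X => /sub1 ny; exists y.
Qed.

Theorem mainTheorem5 (R : comPzRingType) (nn : set R) (d e : nat)
    (f : R) (n : nat)
    (hR : is_buchsbaum nn)
    (hdim : krull_dim R d) (hd : (2 <= d)%N)
    (hmult : multiplicity nn e) (he : (1 < e)%N)
    (hf : nn f) (hdimf : krull_dim (quot [set f]) d.-1)
    (hn : (2 <= n)%N)
    (m : set (quot [set f ^+ n])) (hm : is_maximal m)
    (Q : set (quot [set f ^+ n])) (hQ : parameter_ideal m Q) :
  ideal_exp (ideal_colon Q m) 2 = ideal_mul Q (ideal_colon Q m).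
Proof.
case: d => [|p] // in hdim hd hdimf *.
have [noeth hloc _ _] := hR.
have [mi _ _] := hm; have [ni _ _] := hloc.1.
pose N := Idl ni; pose M := Idl mi.
have [b hbuch] : exists b, _ := @buchsbaum_lengths R N p hR hdim.
have hmn := @multiplicity_has_mult R N _ _ hdim hmult.
have [d' [x [hd' QE Qm [K hK]]]] := hQ.
(* The quotients by [f] and by [f ^+ n] both have dimension [p], so [Q] has [p] generators. *)
have dE := max_chain_uniq hd' (krull_dim_quot_exp (ltnW hn) hdimf); rewrite /= in dE.
subst d'.
pose S := [set f ^+ n]; pose pi := quot_pi S.
have nfn : N (f ^+ n) by case: (n) hn => // k _; rewrite exprS; apply: idlMr.
have mP y : m (pi y) <-> nn y.
  by apply: (preim_maximal (nn := N)) => // _ ->.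
pose QI : idl _ := genI (range x).
have QQI : Q = QI by rewrite QE.
pose a i := quot_repr (x i).
pose s := [seq a i | i <- enum 'I_p].
have fE : f ^+ n = f * f ^+ n.-1 by rewrite -exprS prednK // ltnW.
have pi_f y : pi (f * f ^+ n.-1 * y) = 0.
  rewrite -(quot_pi0 S); apply/quot_pi_eq; rewrite subr0 -fE mulrC.
  by apply: (@idlM _ (genI S)); apply: genI_sub.
(* The preimage of [Q] is generated by the lifts [a i] and [f ^+ n], split as [g * h] with [g = f]
   and [h = f ^+ n.-1]. *)
have QP y : QI (pi y) <-> gen (f * f ^+ n.-1 :: s) y.
  split; last first.
    apply: (@gen_min _ _ (preim QI)) => z; rewrite inE => /predU1P[->|/mapP [i _ ->]].
      change (QI (pi (f * f ^+ n.-1))).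
      by rewrite -[f * _]mulr1 pi_f; apply: idl0.
    by rewrite /= quot_reprK; apply: genI_sub; exists i.
  move=> h; apply: (@im_pi R S) => [_ ->|]; first by rewrite fE; apply: gen_hd.
  apply: (genI_min _ h) => _ [i _ <-]; exists (a i); last by rewrite quot_reprK.
  by apply/gen_tl/gen_mem/map_f; rewrite mem_enum.
have hprim : defining N (f * f ^+ n.-1 :: s).
  split=> [y|].
    rewrite inE => /predU1P[->|/mapP [i _ ->]]; first by rewrite -fE.
    by apply/mP; rewrite /pi quot_reprK; apply: Qm; rewrite QQI; apply: genI_sub; exists i.
  exists K => y hy; apply/QP; rewrite -QQI; apply: hK.
  rewrite (@ideal_exp_powI _ M).
  suff h : forall k, sub (powI N k) (preim (powI M k)) by apply: h hy.
  elim=> [|k IH] //; apply: mulI_min => u v nu hv.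
  change (powI M k.+1 (pi (u * v))); rewrite /pi quot_pi_mul.
  by apply: mulI_in; [exact: (mP u).2|exact: IH].
(* This is where [n >= 2] matters: for [n = 1] the factor [h] would be 1. *)
have nfp : N (f ^+ n.-1) by case: (n) hn => [|[|k]] // _; rewrite exprS; apply: idlMr.
pose J := colon (gen (f * f ^+ n.-1 :: s)) N.
pose IA := colon QI M.
have IJ y : IA (pi y) <-> J y.
  split=> [h z nz|h Z].
    by apply/QP; rewrite /pi quot_pi_mul; apply: h; apply/mP.
  have [z ->] := quot_pi_surj Z => /mP nz.
  by rewrite -quot_pi_mul; apply/QP/h.
have -> : ideal_colon Q m = IA by rewrite QQI.
rewrite QQI ideal_exp_powI; apply/seteqP; split; last first.
  apply: (@mulI_mono _ QI IA IA (powI IA 1)); last exact: powI1.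
  by move=> X QX Y _; apply: idlMr.
change (sub (mulI IA (mulI IA (top _))) (mulI QI IA)); apply: mulI_min => X Z IX /mulI_subl.
move: IX; have [y ->] := quot_pi_surj X; have [z ->] := quot_pi_surj Z.
move=> /IJ Jy /IJ Jz.
have [k [w [hw E]]] := socle_square (nn := N) noeth hloc hbuch hmn he hf nfp hprim Jy Jz.
(* The multiple of [g * h = f ^+ n] vanishes in the quotient, leaving the image of an element of
   [q J]. *)
rewrite -quot_pi_mul E quot_piD -/S -/pi pi_f add0r.
suff: sub (mulI (gen s) J) (preim (mulI QI IA)) by apply.
apply: mulI_min => u v hu hv; change (mulI QI IA (pi (u * v))).
rewrite /pi quot_pi_mul; apply: mulI_in; last exact: (IJ v).2.
by apply: (QP u).2; apply: gen_tl.
Qed.
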